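(* Let $\mathcal R=\mathcal R(\mathbb F_2)$, $\mathcal N=\mathcal N(\mathbb F_2)$, and $\mathcal A$, $\mathcal A_m$ be as in the context. For all integers $n\ge2$, $$\gamma_n(\mathcal R)\cong\mathcal A_{2n-3}\ltimes\gamma_n(\mathcal N),$$ and the lower central quotients are $$\gamma_i(\mathcal R)/\gamma_{i+1}(\mathcal R)\cong\begin{cases}(\mathbb Z_2)^3\times\mathbb Z_4 & \text{if } i=1,\\ (\mathbb Z_2)^4 & \text{if } i\ge2 \text{ is even},\\ (\mathbb Z_2)^6 & \text{if } i>1 \text{ is odd}.\end{cases}$$ Moreover, letting $F_{\mathcal R}:\mathcal R\to\mathcal R^{ab}=\mathcal R/\gamma_2(\mathcal R)$ be the abelianization map, $a=F_{\mathcal R}((1+t,t))$ and $b_i=F_{\mathcal R}((1,t+t^{i+1}))$ for $i\ge1$, the abelian group $\mathcal R^{ab}$ has the presentation $$\langle a,\ b_1,\ b_1b_2,\ b_4\mid a^2=(b_1b_2)^2=b_4^2=b_1^4=1,\ [b_i,b_j]=1,\ [a,b_i]=1\rangle,$$ i.e. $\mathcal R^{ab}$ is the direct product of the cyclic subgroups generated by $a$ (order 2), $b_1$ (order 4), $b_1b_2$ (order 2) and $b_4$ (order 2).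
   Context: The Riordan group $\mathcal R=\mathcal R(\mathbb F_2)$ consists of pairs $(g,f)$ of formal power series over $\mathbb F_2$ with $g=1+g_1t+\cdots$, $f=t+f_2t^2+\cdots$, identified with lower triangular matrices $(d_{n,k})$, $d_{n,k}=[t^n]gf^k$; the product is $(g_1,f_1)(g_2,f_2)=(g_1\cdot(g_2\circ f_1),\,f_2\circ f_1)$, identity $(1,t)$. It is a pro-2 group, the inverse limit of its finite truncations (upper-left $(n+1)\times(n+1)$ corners), with the corresponding profinite ($t$-adic) topology. The Appell subgroup $\mathcal A=\{(g,t)\}$ is normal abelian; for $m\ge0$, $\mathcal A_m=\{(g,t): g\equiv1\pmod{t^{m+1}}\}$. The Nottingham group $\mathcal N=\mathcal N(\mathbb F_2)=\{(1,f)\}$ is a subgroup, and $\mathcal R=\mathcal A\rtimes\mathcal N$. The lower central series is $\gamma_1(G)=G$, $\gamma_{i}(G)=[\gamma_{i-1}(G),G]$, where for closed normal subgroups $X,Y$, $[X,Y]$ is the smallest closed subgroup containing all commutators $[x,y]=x^{-1}y^{-1}xy$, $x\in X$, $y\in Y$. $\mathbb Z_q=\mathbb Z/q\mathbb Z$. *)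

(* Defs.v *)
From HB Require Import structures.
From mathcomp Require Import all_boot all_order all_algebra.
Set Implicit Arguments. Unset Strict Implicit. Unset Printing Implicit Defensive.
Import GRing.Theory.
Local Open Scope ring_scope.

(* Formal power series over F_2: n |-> [t^n] p. *)
Definition ps := nat -> 'F_2.

Definition pone : ps := fun n => (n == 0)%N%:R.
Definition pX : ps := fun n => (n == 1)%N%:R.
Definition pmul (p q : ps) : ps := fun n => \sum_(k < n.+1) p k * q (n - k)%N.
Definition ppow (p : ps) (k : nat) : ps := iter k (pmul p) pone.
(* composition g o f, meaningful when f 0 = 0 *)
Definition pcomp (g f : ps) : ps := fun n => \sum_(k < n.+1) g k * ppow f k n.

(* Riordan arrays as pairs (g, f) *)
Definition RR := (ps * ps)%type.
Definition isR (x : RR) : Prop := x.1 0%N = 1 /\ x.2 0%N = 0 /\ x.2 1%N = 1.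
Definition rid : RR := (pone, pX).
Definition rmul (x y : RR) : RR := (pmul x.1 (pcomp y.1 x.2), pcomp y.2 x.2).

Definition Rg : RR -> Prop := isR.
Definition Ng : RR -> Prop := fun x => isR x /\ x.1 = pone.
Definition Ag : RR -> Prop := fun x => isR x /\ x.2 = pX.
Definition Am (m : nat) : RR -> Prop :=
  fun x => Ag x /\ forall n, (0 < n)%N -> (n <= m)%N -> x.1 n = 0.

(* t-adic topology: x, y agree on all coefficients of index < N *)
Definition agree (N : nat) (x y : RR) : Prop :=
  forall n, (n < N)%N -> x.1 n = y.1 n /\ x.2 n = y.2 n.
Definition closedR (S : RR -> Prop) : Prop :=
  forall x, isR x -> (forall N, exists y, S y /\ agree N x y) -> S x.
Definition subgroupR (S : RR -> Prop) : Prop :=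
  [/\ (forall x, S x -> isR x), S rid,
      (forall x y, S x -> S y -> S (rmul x y)) &
      (forall x y, S x -> isR y -> rmul x y = rid -> S y)].
Definition gen_closed (T : RR -> Prop) : RR -> Prop :=
  fun x => forall H, subgroupR H -> closedR H -> (forall y, T y -> H y) -> H x.

(* c = [x,y] = x^-1 y^-1 x y, i.e. c is the element of R with y x c = x y *)
Definition is_comm (x y c : RR) : Prop := isR c /\ rmul (rmul y x) c = rmul x y.

(* lcs G k = gamma_{k+1}(G) *)
Fixpoint lcs (G : RR -> Prop) (k : nat) : RR -> Prop :=
  match k with
  | 0 => G
  | k'.+1 => gen_closed (fun c => exists x y, lcs G k' x /\ G y /\ is_comm x y c)
  end.
Definition gamma (G : RR -> Prop) (i : nat) : RR -> Prop := lcs G i.-1.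

(* phi induces an isomorphism G/K ~= H (first isomorphism theorem form) *)
Definition quot_iso (G K : RR -> Prop) (H : zmodType) (phi : RR -> H) : Prop :=
  [/\ (forall x y, G x -> G y -> phi (rmul x y) = phi x + phi y),
      (forall h, exists x, G x /\ phi x = h) &
      (forall x, G x -> (phi x = 0 <-> K x))].

Definition ael : RR := (fun n => (n <= 1)%N%:R, pX).
Definition bel (i : nat) : RR := (pone, fun n => ((n == 1) || (n == i.+1))%N%:R).

(* Main.v *)
(* Over F_2 every series is f = t u(t)^2 + v(t)^2, and composition becomes
     u_{f o g} = (u_f o g) u_g,    v_{f o g} = v_g (u_f o g) + v_f o g,
   so u is a cocycle of the same kind as the first component of a Riordan array.
   In these coordinates gamma_n(N), n >= 2, consists of the f with
     v = 0 mod t^n,  u = 1 mod t^(2n-2)  and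
     u_{2n-1} = v_n (n odd),  u_{2n-2} = v_n, u_{2n-1} = 0 (n >= 4 even),
     u_2 = u_3 = v_2 (n = 2),
   and gamma_n(R) consists of the (g, f) with g = 1 mod t^(2n-2) and f as above.
   Call the latter set Gamma_n.  Coefficients just above the defining ones give
   an additive map on Gamma_n with kernel Gamma_{n+1}, so Gamma_n is a closed
   subgroup.  The first two coefficients of a commutator [f, g] are bilinear in
   the leading coefficients of f and the coefficients g_2, g_3 of g; this shows
   [Gamma_n, R] <= Gamma_{n+1}, and that these commutators generate
   Gamma_{n+1} modulo Gamma_{n+2}.  Since the Gamma_m shrink to the identity,
   their closed span is all of Gamma_{n+1}. *)
Require Import Defs.
From HB Require Import structures.
From mathcomp Require Import all_boot all_order all_algebra.
From Stdlib Require Import FunctionalExtensionality Ring.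
Set Implicit Arguments. Unset Strict Implicit. Unset Printing Implicit Defensive.
Import GRing.Theory.
Local Open Scope ring_scope.

(** * Power series over F_2 as a ring *)

Lemma F2P (x : 'F_2) : x = 0 \/ x = 1.
Proof. by case: x => [[|[|m]] lt_m] //; [left|right]; apply: val_inj. Qed.

Lemma addFF (x : 'F_2) : x + x = 0.
Proof. by case: (F2P x) => ->; apply: val_inj. Qed.

Lemma mulFF (x : 'F_2) : x * x = x.
Proof. by case: (F2P x) => ->; apply: val_inj. Qed.

Lemma addF_eq0 (x y : 'F_2) : x + y = 0 -> x = y.
Proof. by case: (F2P x) => ->; case: (F2P y) => -> // /(congr1 val). Qed.

(* Monomorphic copies of the operations of ['F_2], on which the [ring] tactic
   can be declared with coefficients in [bool], so that it knows [2 = 0]. *)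
Definition F2 : Type := 'F_2.
Definition F2zero : F2 := (0 : 'F_2).
Definition F2one : F2 := (1 : 'F_2).
Definition F2add (x y : F2) : F2 := (x : 'F_2) + y.
Definition F2mul (x y : F2) : F2 := (x : 'F_2) * y.

Lemma F2_ring : ring_theory F2zero F2one F2add F2mul F2add id (@eq F2).
Proof.
split=> //; [exact: add0r|exact: addrC|exact: addrA|exact: mul1r|exact: mulrC
  |exact: mulrA|exact: mulrDl|exact: addFF].
Qed.

Lemma F2_morph : ring_morph F2zero F2one F2add F2mul F2add id (@eq F2)
  false true xorb andb xorb id Bool.eqb (fun b => if b then F2one else F2zero).
Proof. by split=> //; case=> -[] //= *; apply: val_inj. Qed.

Ltac F2_const t :=
  match t with
  | F2one => constr:(true)
  | F2zero => constr:(false)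
  | _ => constr:(InitialRing.NotConstant)
  end.

Add Ring F2_ring : F2_ring (morphism F2_morph, constants [F2_const]).

Lemma F2addE (x y : 'F_2) : x + y = F2add x y. Proof. by []. Qed.
Lemma F2mulE (x y : 'F_2) : x * y = F2mul x y. Proof. by []. Qed.
Lemma F2zeroE : (0 : 'F_2) = F2zero. Proof. by []. Qed.
Lemma F2oneE : (1 : 'F_2) = F2one. Proof. by []. Qed.
Lemma eq_F2 (x y : 'F_2) : F2add x F2zero = F2add y F2zero -> x = y.
Proof. by rewrite /F2add !addr0. Qed.

Ltac F2ring :=
  rewrite ?(F2addE, F2mulE, F2zeroE, F2oneE); apply: eq_F2; ring.

Definition padd (p q : ps) : ps := fun n => p n + q n.
Definition pzero : ps := fun=> 0.

Declare Scope ps_scope.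
Delimit Scope ps_scope with S.
Infix "+" := padd : ps_scope.
Infix "*" := pmul : ps_scope.
Notation "0" := pzero : ps_scope.
Notation "1" := pone : ps_scope.
Notation "p @@ f" := (Defs.pcomp p f) (at level 30, right associativity) : ps_scope.
Bind Scope ps_scope with ps.

Lemma psP (p q : ps) : p =1 q -> p = q.
Proof. exact: functional_extensionality. Qed.

(** Coefficients below [N] only see truncations below [N], so the ring laws of series can be
    borrowed from polynomials. *)
Lemma coef_pmul (p q : ps) N n : (n < N)%N ->
  (p * q)%S n = ((\poly_(i < N) p i) * (\poly_(i < N) q i))`_n.
Proof.
move=> ltnN; rewrite coefM; apply: eq_bigr => k _.
rewrite !coef_poly (leq_ltn_trans (leq_subr _ _) ltnN).
by rewrite (leq_ltn_trans (leq_ord k) ltnN).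
Qed.

Lemma pmulC (p q : ps) : (p * q)%S = (q * p)%S.
Proof. by apply: psP => n; rewrite !(@coef_pmul _ _ n.+1) // mulrC. Qed.

Lemma pmulA (p q r : ps) : (p * (q * r))%S = (p * q * r)%S.
Proof.
apply: psP => n.
transitivity (((\poly_(i < n.+1) p i) * ((\poly_(i < n.+1) q i) *
   (\poly_(i < n.+1) r i)))`_n).
  rewrite coefM; apply: eq_bigr => k _; rewrite coef_poly ltn_ord.
  by rewrite (@coef_pmul _ _ n.+1) // ltnS leq_subr.
rewrite mulrA coefM; apply: eq_bigr => k _; rewrite coef_poly ltnS leq_subr.
by rewrite (@coef_pmul _ _ n.+1).
Qed.

Lemma pmul1s (p : ps) : (1 * p)%S = p.
Proof.
apply: psP => n; rewrite /pmul big_ord_recl /= /pone mul1r subn0.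
by rewrite big1 ?addr0 // => i _; rewrite mul0r.
Qed.

Lemma pmulDl (p q r : ps) : ((p + q) * r)%S = (p * r + q * r)%S.
Proof.
apply: psP => n; rewrite /pmul /padd -big_split /=.
by apply: eq_bigr => i _; rewrite mulrDl.
Qed.

Lemma ps_ring : ring_theory 0%S 1%S padd pmul padd id (@eq ps).
Proof.
split=> //.
- by move=> p; apply: psP => n; rewrite /padd add0r.
- by move=> p q; apply: psP => n; rewrite /padd addrC.
- by move=> p q r; apply: psP => n; rewrite /padd addrA.
- exact: pmul1s.
- exact: pmulC.
- exact: pmulA.
- exact: pmulDl.
- by move=> p; apply: psP => n; rewrite /padd addFF.
Qed.

Definition pbool (b : bool) : ps := if b then 1%S else 0%S.

Lemma pbool_morph : ring_morph 0%S 1%S padd pmul padd id (@eq ps)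
  false true xorb andb xorb id Bool.eqb pbool.
Proof.
split=> //.
- case=> -[] //=; apply: psP => n; rewrite /padd ?addFF ?addr0 ?add0r //.
- case=> -[] //=; apply: psP => n; rewrite /padd ?addFF ?addr0 ?add0r //.
- case=> -[] //=; rewrite ?pmul1s // ?(pmulC 0%S) ?pmul1s //.
  by apply: psP => n; rewrite /pmul big1 // => i _; rewrite mulr0.
- by case=> -[].
Qed.

Ltac ps_const t :=
  match t with
  | pone => constr:(true)
  | pzero => constr:(false)
  | _ => constr:(InitialRing.NotConstant)
  end.

Add Ring ps_ring : ps_ring (morphism pbool_morph, constants [ps_const]).

(** * Composition of power series *)

Implicit Types (p q r f g : ps).

Definition eqm (N : nat) (p q : ps) : Prop := forall n, (n < N)%N -> p n = q n.
Definition pshift (p : ps) : ps := fun n => p n.+1.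
Definition pC (c : 'F_2) : ps := fun n => if n == 0%N then c else 0.

Lemma pC0 : pC 0 = 0%S. Proof. by apply: psP; case. Qed.
Lemma pC1 : pC 1 = 1%S. Proof. by apply: psP; case. Qed.

Lemma coef_pXM (p : ps) n : (pX * p)%S n = if n is m.+1 then p m else 0.
Proof.
case: n => [|n]; rewrite /pmul big_ord_recl /pX /= mul0r add0r ?big_ord0 //.
rewrite big_ord_recl /= mul1r big1 ?addr0 // => [|i _]; last by rewrite mul0r.
by rewrite /bump /= subn1.
Qed.

Lemma coef_pXMS (p : ps) n : (pX * p)%S n.+1 = p n.
Proof. by rewrite coef_pXM. Qed.

Lemma coef_pCM (a : 'F_2) (p : ps) n : (pC a * p)%S n = a * p n.
Proof.
rewrite /pmul big_ord_recl /= subn0 big1 ?addr0 // => i _.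
by rewrite mul0r.
Qed.

Lemma ps_decomp (p : ps) : p = (pC (p 0%N) + pX * pshift p)%S.
Proof. by apply: psP => -[|n]; rewrite /padd coef_pXM /= ?addr0 ?add0r. Qed.

Lemma pshiftXM (p : ps) : pshift (pX * p)%S = p.
Proof. by apply: psP => n; rewrite /pshift coef_pXM. Qed.

Lemma pmul_coef0 (p q : ps) : (p * q)%S 0%N = p 0%N * q 0%N.
Proof. by rewrite /pmul big_ord_recl big_ord0 addr0. Qed.

Lemma pmul_coef1 (p q : ps) : (p * q)%S 1%N = p 0%N * q 1%N + p 1%N * q 0%N.
Proof. by rewrite /pmul !big_ord_recl big_ord0 addr0. Qed.

Lemma pmul_coef2 (p q : ps) :
  (p * q)%S 2%N = p 0%N * q 2%N + p 1%N * q 1%N + p 2%N * q 0%N.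
Proof. by rewrite /pmul !big_ord_recl big_ord0 addr0 addrA. Qed.

Lemma pmul_coef3 (p q : ps) :
  (p * q)%S 3%N = p 0%N * q 3%N + p 1%N * q 2%N + p 2%N * q 1%N + p 3%N * q 0%N.
Proof. by rewrite /pmul !big_ord_recl big_ord0 addr0 !addrA. Qed.

Lemma eqm_refl N p : eqm N p p. Proof. by []. Qed.
Lemma eqm_trans N p q r : eqm N p q -> eqm N q r -> eqm N p r.
Proof. by move=> e e' n ltn; rewrite e ?e'. Qed.
Lemma eqmW N M p q : (N <= M)%N -> eqm M p q -> eqm N p q.
Proof. by move=> le e n ltn; apply: e; apply: leq_trans le. Qed.

Lemma eqmP p q : (forall N, eqm N p q) -> p = q.
Proof. by move=> e; apply: psP => n; apply: (e n.+1). Qed.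

Lemma eqmD N p q p' q' : eqm N p q -> eqm N p' q' -> eqm N (p + p')%S (q + q')%S.
Proof. by move=> e e' n ltn; rewrite /padd e ?e'. Qed.

Lemma eqmM N p q p' q' : eqm N p q -> eqm N p' q' -> eqm N (p * p')%S (q * q')%S.
Proof.
move=> e e' n ltn; apply: eq_bigr => i _.
rewrite e ?e' //; last by apply: leq_ltn_trans ltn; rewrite -ltnS.
by apply: leq_ltn_trans ltn; rewrite leq_subr.
Qed.

Lemma eqmXM N p q : eqm N p q -> eqm N.+1 (pX * p)%S (pX * q)%S.
Proof. by move=> e [|n] ltn; rewrite !coef_pXM //; apply: e. Qed.

Lemma series0 (f : ps) : f 0%N = 0 -> f = (pX * pshift f)%S.
Proof. by move=> f0; rewrite {1}(ps_decomp f) f0 pC0; ring. Qed.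

(** A factor without constant term gains one order of precision; this drives the inductions on
    precision below. *)
Lemma eqmM0 N p q f : f 0%N = 0 -> eqm N p q -> eqm N.+1 (f * p)%S (f * q)%S.
Proof.
move=> /series0-> e; rewrite -!pmulA; apply: eqmXM; exact: eqmM.
Qed.

Lemma ppowS f k : ppow f k.+1 = (f * ppow f k)%S. Proof. by []. Qed.

Lemma ppow_small f k n : f 0%N = 0 -> (n < k)%N -> ppow f k n = 0.
Proof.
move=> f0; elim: k n => // k IH n ltnk; rewrite ppowS {1}(series0 f0) -pmulA coef_pXM.
case: n ltnk => // n; rewrite ltnS => ltnk; rewrite /pmul big1 // => i _.
by rewrite IH ?mulr0 //; apply: leq_ltn_trans ltnk; rewrite leq_subr.
Qed.

Lemma pcompD p q f : ((p + q) @@ f = p @@ f + q @@ f)%S.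
Proof.
apply: psP => n; rewrite /Defs.pcomp /padd -big_split /=.
by apply: eq_bigr => i _; rewrite mulrDl.
Qed.

Lemma pcomp_pC (a : 'F_2) f : (pC a @@ f = pC a)%S.
Proof.
apply: psP => n; rewrite /Defs.pcomp big_ord_recl /= big1 ?addr0; last first.
  by move=> i _; rewrite mul0r.
by case: n => [|n]; rewrite /pone /pC /= ?mulr1 ?mulr0.
Qed.

Lemma pcomp1 f : (1 @@ f = 1)%S.
Proof. by rewrite -pC1 pcomp_pC. Qed.

(** The power [ppow f k] starts in degree at least [k], so the summands with [k > n] vanish. *)
Lemma pcomp_widen p f n N : f 0%N = 0 -> (n < N)%N ->
  (p @@ f)%S n = \sum_(k < N) p k * ppow f k n.
Proof.
move=> f0 ltnN; rewrite /Defs.pcomp (big_ord_widen N (fun k => p k * ppow f k n)) //.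
rewrite big_mkcond; apply: eq_bigr => k _; case: ltnP => // ltnk.
by rewrite ppow_small ?mulr0.
Qed.

(** Horner's rule for [p = p_0 + t p']. The laws of composition follow from it by induction on
    precision, since the tail is multiplied by [f]. *)
Lemma pcomp_unfold p f : f 0%N = 0 -> (p @@ f = pC (p 0%N) + f * (pshift p @@ f))%S.
Proof.
move=> f0; apply: psP => n; rewrite /padd /Defs.pcomp big_ord_recl /=; congr (_ + _).
  by case: n => [|n]; rewrite /pone /pC /= ?mulr1 ?mulr0.
rewrite [RHS]/pmul.
transitivity (\sum_(j < n.+1) \sum_(k < n) f j * (p k.+1 * ppow f k (n - j)%N)).
  rewrite exchange_big /=; apply: eq_bigr => k _.
  transitivity (p k.+1 * (f * ppow f k)%S n); first by [].
  rewrite /pmul mulr_sumr; apply: eq_bigr => j _.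
  by rewrite mulrCA.
apply: eq_bigr => -[[|j] /= ltj] _; first by rewrite f0 mul0r big1 // => k; rewrite mul0r.
rewrite -mulr_sumr; congr (_ * _); symmetry; apply: (@pcomp_widen (pshift p)) => //.
by move: ltj; case: n => // n; rewrite !ltnS => lejn; rewrite subSS leq_subr.
Qed.

Lemma pcomp_XM p f : f 0%N = 0 -> ((pX * p) @@ f = f * (p @@ f))%S.
Proof. by move=> f0; rewrite pcomp_unfold // pshiftXM coef_pXM pC0; ring. Qed.

Lemma pcomp_X f : f 0%N = 0 -> (pX @@ f = f)%S.
Proof.
move=> f0; have -> : pX = (pX * 1)%S by ring.
by rewrite pcomp_XM // pcomp1; ring.
Qed.

Lemma pcompM p q f : f 0%N = 0 -> ((p * q) @@ f = (p @@ f) * (q @@ f))%S.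
Proof.
move=> f0; apply: eqmP => N; elim: N p => // N IH p.
rewrite {1}(ps_decomp p) (pcomp_unfold p f0).
have -> : ((pC (p 0%N) + pX * pshift p) * q = pC (p 0%N) * q + pX * (pshift p * q))%S by ring.
have -> : ((pC (p 0%N) + f * (pshift p @@ f)) * (q @@ f) =
           pC (p 0%N) * (q @@ f) + f * ((pshift p @@ f) * (q @@ f)))%S by ring.
rewrite pcompD pcomp_XM //; apply: eqmD; last exact: eqmM0 (IH _).
case: (F2P (p 0%N)) => ->; rewrite ?pC0 ?pC1.
  have c0 : (0 @@ f = 0)%S by rewrite -pC0 pcomp_pC.
  have m0 r : (0 * r = 0)%S by ring.
  by rewrite !m0 c0.
by rewrite !pmul1s.
Qed.

Lemma pcomp_coef0 p f : f 0%N = 0 -> (p @@ f)%S 0%N = p 0%N.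
Proof. by move=> f0; rewrite pcomp_unfold // /padd pmul_coef0 f0 mul0r addr0. Qed.

Lemma pcompA p f g : f 0%N = 0 -> g 0%N = 0 -> ((p @@ f) @@ g = p @@ (f @@ g))%S.
Proof.
move=> f0 g0; have fg0 : (f @@ g)%S 0%N = 0 by rewrite pcomp_coef0.
apply: eqmP => N; elim: N p => // N IH p.
rewrite (pcomp_unfold p f0) (pcomp_unfold p fg0) pcompD pcomp_pC pcompM //.
by apply: eqmD => //; apply: eqmM0 (IH _).
Qed.

Lemma pcomp_id p : (p @@ pX = p)%S.
Proof.
apply: eqmP => N; elim: N p => // N IH p.
rewrite pcomp_unfold // [X in eqm _ _ X](ps_decomp p); apply: eqmD => //.
exact: eqmXM (IH _).
Qed.

Lemma eqm_comp N p f g : f 0%N = 0 -> g 0%N = 0 -> eqm N f g ->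
  eqm N (p @@ f)%S (p @@ g)%S.
Proof.
move=> f0 g0; elim: N p => // N IH p e; rewrite (pcomp_unfold p f0) (pcomp_unfold p g0).
apply: eqmD => //; apply: (@eqm_trans _ _ (g * (pshift p @@ f))%S).
  exact: eqmM.
by apply: eqmM0 => //; apply: IH; apply: eqmW e.
Qed.

Lemma eqm_compl N p q f : f 0%N = 0 -> eqm N p q -> eqm N (p @@ f)%S (q @@ f)%S.
Proof.
move=> f0 e n ltn; rewrite !(@pcomp_widen _ _ _ N) //.
by apply: eq_bigr => k _; rewrite e.
Qed.

Lemma triangular_solve (m : nat -> nat -> 'F_2) (p : ps) :
  (forall n, m n n = 1) ->
  exists g : ps, forall n, \sum_(k < n.+1) g k * m k n = p n.
Proof.
move=> m1.
pose next s := rcons s (p (size s) + \sum_(k < size s) nth 0 s k * m k (size s)).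
pose s n := iter n next [::]; have szs n : size (s n) = n.
  by elim: n => //= n IH; rewrite size_rcons IH.
have nths n k : (k < n)%N -> nth 0 (s n) k = nth 0 (s k.+1) k.
  elim: n => // n IH; rewrite ltnS leq_eqVlt => /predU1P[->//|ltk].
  by rewrite [s n.+1]/= nth_rcons szs ltk IH.
exists (fun k => nth 0 (s k.+1) k) => n.
rewrite big_ord_recr /= nth_rcons szs ltnn eqxx m1 mulr1.
rewrite addrCA -[RHS]addr0; congr (_ + _).
rewrite (eq_bigr (fun k : 'I_n => nth 0 (s n) k * m k n)) ?addFF // => k _.
by rewrite -/(next _) -[next (s k)]/(s k.+1) (nths n).
Qed.

Lemma ppow_diag f n : f 0%N = 0 -> f 1%N = 1 -> ppow f n n = 1.
Proof.
move=> f0 f1; elim: n => // n IH; rewrite ppowS {1}(series0 f0) -pmulA coef_pXM.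
rewrite /pmul big_ord_recl /= subn0 IH /pshift f1 mulr1 big1 ?addr0 // => i _.
by rewrite ppow_small ?mulr0 // ltn_subrL /= (leq_ltn_trans _ (ltn_ord i)).
Qed.

(** Composition with [f] acts on coefficients by the matrix of (1, f), which is unitriangular. *)
Lemma pcomp_surj f p : f 0%N = 0 -> f 1%N = 1 -> exists g : ps, (g @@ f)%S = p.
Proof.
move=> f0 f1; have [g gP] := triangular_solve p (fun n => ppow_diag n f0 f1).
by exists g; apply: psP.
Qed.

Lemma mul_surj q p : q 0%N = 1 -> exists g : ps, (q * g)%S = p.
Proof.
move=> q0; have [|g gP] := @triangular_solve (fun k n => q (n - k)%N) p.
  by move=> n; rewrite subnn.
by exists g; rewrite pmulC; apply: psP => n; rewrite -gP.
Qed.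

Lemma pcomp_coef1 p f : f 0%N = 0 -> (p @@ f)%S 1%N = p 1%N * f 1%N.
Proof.
move=> f0; rewrite pcomp_unfold // /padd pmul_coef1 f0 mul0r add0r /pC /= add0r.
by rewrite pcomp_coef0 // mulrC.
Qed.

(** * The Riordan group and the coordinates u, v *)

Lemma isR_mul x y : isR x -> isR y -> isR (rmul x y).
Proof.
move=> [x10 [x20 x21]] [y10 [y20 y21]]; rewrite /isR /=.
rewrite pmul_coef0 !pcomp_coef0 // pcomp_coef1 //.
by rewrite x10 y10 x21 y20 y21 !mulr1.
Qed.

Lemma rmulA x y z : isR x -> isR y -> isR z -> rmul x (rmul y z) = rmul (rmul x y) z.
Proof.
move=> [_ [x20 _]] [_ [y20 _]] _; rewrite /rmul /=.
by rewrite pcompM // !pcompA // pmulA.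
Qed.

Lemma rmul1x x : isR x -> rmul rid x = x.
Proof. by case: x => x1 x2 _; rewrite /rmul /= !pcomp_id pmul1s. Qed.

Lemma rmulx1 x : isR x -> rmul x rid = x.
Proof.
case: x => x1 x2 [_ [/= x20 _]].
by rewrite /rmul /= pcomp1 pcomp_X // pmulC pmul1s.
Qed.

Lemma rinv_ex x : isR x -> exists y, [/\ isR y, rmul x y = rid & rmul y x = rid].
Proof.
(* Right inverses suffice: if xy = 1 and yz = 1, then x = x(yz) = (xy)z = z. *)
have rinv x' : isR x' -> exists2 y, isR y & rmul x' y = rid.
  case: x' => x1 x2 [/= x10 [x20 x21]].
  have [y2 y2P] := pcomp_surj pX x20 x21.
  have [q qP] := mul_surj 1%S x10.
  have [y1 y1P] := pcomp_surj q x20 x21.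
  exists (y1, y2); last by rewrite /rmul /= y1P qP y2P.
  split=> /=; last split.
  - move: (congr1 (fun p : ps => p 0%N) qP).
    by rewrite -y1P pmul_coef0 pcomp_coef0 // x10 mul1r.
  - by move: (congr1 (fun p : ps => p 0%N) y2P); rewrite pcomp_coef0.
  - by move: (congr1 (fun p : ps => p 1%N) y2P); rewrite pcomp_coef1 // x21 mulr1.
move=> Rx; have [y Ry xy] := rinv _ Rx; have [z Rz yz] := rinv _ Ry.
exists y; split=> //; rewrite -[RHS]yz; congr (rmul y _).
by rewrite -(rmulx1 Rx) -yz rmulA // xy rmul1x.
Qed.

Lemma comm_ex x y : isR x -> isR y -> exists c, is_comm x y c.
Proof.
move=> Rx Ry; have Ryx := isR_mul Ry Rx; have Rxy := isR_mul Rx Ry.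
have [z [Rz zr _]] := rinv_ex Ryx.
exists (rmul z (rmul x y)); split; first exact: isR_mul.
by rewrite rmulA // zr rmul1x.
Qed.

Lemma pcomp_inv f : f 0%N = 0 -> f 1%N = 1 ->
  exists g, [/\ g 0%N = 0, g 1%N = 1 & (f @@ g)%S = pX].
Proof.
move=> f0 f1; have [|[y1 g] [[_ [g0 g1]] _]] := @rinv_ex (1%S, f); first by [].
by case=> _ fg; exists g.
Qed.

(* [od f] and [ev f] are the series u and v with f = t u^2 + v^2. *)
Definition od (f : ps) : ps := fun n => f n.*2.+1.
Definition ev (f : ps) : ps := fun n => f n.*2.

Lemma padd_coef p q n : (p + q)%S n = p n + q n. Proof. by []. Qed.

(** Squaring is additive in characteristic 2 and fixes constants of F_2. Iterating this step gives
    the Frobenius identity p(t)^2 = p(t^2). *)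
Lemma sq_decomp p : (p * p = pC (p 0%N) + pX * (pX * (pshift p * pshift p)))%S.
Proof.
have -> : pC (p 0%N) = (pC (p 0%N) * pC (p 0%N))%S.
  by apply: psP => -[|n]; rewrite coef_pCM /= ?mulFF ?mulr0.
by rewrite {1 2}(ps_decomp p); ring.
Qed.

Lemma coef_sq_even p n : (p * p)%S n.*2 = p n.
Proof.
elim: n p => [|n IH] p; first by rewrite pmul_coef0 mulFF.
by rewrite sq_decomp padd_coef doubleS !coef_pXMS IH add0r.
Qed.

Lemma coef_sq_odd p n : (p * p)%S n.*2.+1 = 0.
Proof.
elim: n p => [|n IH] p; first by rewrite pmul_coef1 mulrC addFF.
by rewrite sq_decomp padd_coef doubleS !coef_pXMS IH addr0.
Qed.

Lemma od_unique p q : od (pX * (p * p) + q * q)%S = p.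
Proof.
by apply: psP => n; rewrite /od padd_coef coef_pXMS coef_sq_even coef_sq_odd addr0.
Qed.

Lemma ev_unique p q : ev (pX * (p * p) + q * q)%S = q.
Proof.
apply: psP => n; rewrite /ev padd_coef coef_sq_even.
case: n => [|n]; first by rewrite coef_pXM add0r.
by rewrite doubleS coef_pXMS coef_sq_odd add0r.
Qed.

Lemma od_evE f : f = (pX * (od f * od f) + ev f * ev f)%S.
Proof.
have odE := od_unique (od f) (ev f); have evE := ev_unique (od f) (ev f).
apply: psP => n; rewrite -(odd_double_half n); case: (odd n).
  by rewrite add1n; symmetry; exact: (congr1 (fun p : ps => p n./2) odE).
by rewrite add0n; symmetry; exact: (congr1 (fun p : ps => p n./2) evE).
Qed.

(** Substitute [f = t u^2 + v^2], then expand the outer factor [g] in the same way and collect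
    squares. *)
Lemma pcomp_od_ev f g : g 0%N = 0 -> (f @@ g =
  pX * ((od f @@ g) * od g * ((od f @@ g) * od g)) +
  (ev g * (od f @@ g) + ev f @@ g) * (ev g * (od f @@ g) + ev f @@ g))%S.
Proof.
move=> g0; rewrite {1}(od_evE f) pcompD pcomp_XM // !pcompM // {1}(od_evE g).
ring.
Qed.

Lemma od_comp f g : g 0%N = 0 -> od (f @@ g)%S = ((od f @@ g) * od g)%S.
Proof. by move=> g0; rewrite pcomp_od_ev // od_unique. Qed.

Lemma ev_comp f g : g 0%N = 0 -> ev (f @@ g)%S = (ev g * (od f @@ g) + ev f @@ g)%S.
Proof. by move=> g0; rewrite pcomp_od_ev // ev_unique. Qed.

(** * Divisibility by powers of t and leading terms *)

Notation "'t^ k" := (ppow pX k) (at level 8, k at level 2, format "''t^' k").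

Lemma ppowSM k p : ('t^ k.+1 * p = pX * ('t^ k * p))%S.
Proof. by rewrite ppowS; ring. Qed.

Lemma coef_tnM k p n : ('t^ k * p)%S n = if (n < k)%N then 0 else p (n - k)%N.
Proof.
elim: k n => [|k IH] n; first by rewrite pmul1s subn0.
by rewrite ppowSM coef_pXM; case: n => [|n] //; rewrite IH ltnS subSS.
Qed.

Lemma tn_factor k p : (forall n, (n < k)%N -> p n = 0) ->
  p = ('t^ k * (fun n => p (k + n)%N))%S.
Proof.
move=> p0; apply: psP => n; rewrite coef_tnM; case: ltnP => [/p0//|lekn].
by rewrite subnKC.
Qed.

Lemma tn_inj k p q : ('t^ k * p = 't^ k * q)%S -> p = q.
Proof.
move=> e; apply: psP => n; have := congr1 (fun r : ps => r (k + n)%N) e.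
by rewrite !coef_tnM ltnNge leq_addr /= addKn.
Qed.

Lemma ppowD f k l : (ppow f (k + l) = ppow f k * ppow f l)%S.
Proof.
elim: k => [|k IH]; first by rewrite pmul1s.
by rewrite addSn !ppowS IH; ring.
Qed.

Lemma ppowMl f g k : (ppow (f * g) k = ppow f k * ppow g k)%S.
Proof.
elim: k => [|k IH]; first by rewrite pmul1s.
by rewrite !ppowS IH; ring.
Qed.

Lemma ppow_double f k : (ppow f k.*2 = ppow (f * f) k)%S.
Proof. by rewrite -addnn ppowD -ppowMl. Qed.

Lemma ppow_comp f g k : g 0%N = 0 -> (ppow f k @@ g = ppow (f @@ g) k)%S.
Proof.
move=> g0; elim: k => [|k IH]; first exact: pcomp1.
by rewrite !ppowS pcompM // IH.
Qed.

Lemma tn_comp k g : g 0%N = 0 -> ('t^ k @@ g = 't^ k * ppow (pshift g) k)%S.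
Proof. by move=> g0; rewrite ppow_comp // pcomp_X // {1}(series0 g0) ppowMl. Qed.

(** Composing with the compositional inverse of [f] recovers [p], and composition preserves
    divisibility by [t^k]. *)
Lemma pcomp_small p f k : f 0%N = 0 -> f 1%N = 1 ->
  (forall n, (n < k)%N -> (p @@ f)%S n = 0) -> forall n, (n < k)%N -> p n = 0.
Proof.
move=> f0 f1 pf n ltn; have [g [g0 g1 fg]] := pcomp_inv f0 f1.
rewrite -(pcomp_id p) -fg -pcompA // (@eqm_compl k _ 0%S g g0 _ n ltn) => [|i lti].
  by rewrite -pC0 pcomp_pC pC0.
by rewrite pf.
Qed.

(** As [f] is t times a series with constant term 1, so is [f^k] relative to [t^k]. *)
Lemma pcomp_lead p f k : f 0%N = 0 -> f 1%N = 1 ->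
  (forall n, (n < k)%N -> p n = 0) -> (p @@ f)%S k = p k.
Proof.
move=> f0 f1 p0; rewrite {1}(tn_factor p0) pcompM // tn_comp // -pmulA.
rewrite coef_tnM ltnn subnn pmul_coef0 pcomp_coef0 // addn0.
have -> : ppow (pshift f) k 0%N = 1; last by rewrite mul1r.
by elim: k {p0} => // k IH; rewrite ppowS pmul_coef0 IH mulr1.
Qed.

Lemma inv_ex p : p 0%N = 1 -> exists q, (p * q = 1)%S.
Proof. exact: mul_surj. Qed.

Lemma eqm_factor k p q : eqm k p q -> exists r, (p = q + 't^ k * r)%S.
Proof.
move=> e; have /tn_factor pqE : forall n, (n < k)%N -> (p + q)%S n = 0.
  by move=> n ltn; rewrite padd_coef e // addFF.
exists (fun n => (p + q)%S (k + n)%N); rewrite -pqE.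
by ring.
Qed.

(** * Two-term expansions of powers, compositions and commutators *)

Implicit Types (b c e A B : ps).

Lemma pC_0 (x : 'F_2) : pC x 0%N = x. Proof. by []. Qed.
Lemma pC_1 (x : 'F_2) : pC x 1%N = 0. Proof. by []. Qed.
Lemma pX_0 : pX 0%N = 0. Proof. by []. Qed.
Lemma pX_1 : pX 1%N = 1. Proof. by []. Qed.
Lemma pone_0 : pone 0%N = 1. Proof. by []. Qed.
Lemma pone_1 : pone 1%N = 0. Proof. by []. Qed.

Definition jetE := (padd_coef, pmul_coef0, pmul_coef1, pC_0, pC_1, pX_0, pX_1,
  pone_0, pone_1, mul0r, mulr0, mul1r, mulr1, addr0, add0r).

(** The cross terms of the power start at [t^4], two orders above the first term, so the first two
    coefficients are linear in [p]. *)
Lemma ppow_sq_jet p k : exists q, (ppow (1 + pX * (pX * p)) k = 1 + pX * (pX * q))%S /\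
  q 0%N = k%:R * p 0%N /\ q 1%N = k%:R * p 1%N.
Proof.
elim: k => [|k [q [qE [q0 q1]]]].
  by exists 0%S; rewrite !mul0r; split=> //; rewrite [LHS]/ppow /=; ring.
exists (p + q + pX * (pX * (p * q)))%S; rewrite ppowS qE; split; first by ring.
by rewrite !jetE q0 q1 -!natr1; split; F2ring.
Qed.

Lemma decomp2 p : p = (pC (p 0%N) + pX * (pC (p 1%N) + pX * pshift (pshift p)))%S.
Proof. by rewrite {1}(ps_decomp p) {1}(ps_decomp (pshift p)). Qed.

(** The power is the [k]-th power of [w^2], and a square has only even-degree terms. *)
Lemma ppow_even_jet w k : w 0%N = 1 -> exists q,
  (ppow w k.*2 = 1 + pX * (pX * q))%S /\ q 0%N = k%:R * w 1%N /\ q 1%N = 0.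
Proof.
move=> w0; have [q [qE [q0 q1]]] := ppow_sq_jet (pshift w * pshift w)%S k.
exists q; split.
  by rewrite ppow_double -qE sq_decomp w0 pC1.
rewrite q0 q1 pmul_coef0 mulFF; split=> //.
by rewrite (coef_sq_odd _ 0) mulr0.
Qed.

(** First-order Taylor expansion: to this precision the increment is [p'] times [t^(k+2) B]. Over
    F_2 the derivative [p'] has no linear term, so only [p 1] enters. *)
Lemma taylor_jet p f B k : (f = pX + pX * (pX * ('t^ k * B)))%S ->
  exists Q, (p @@ f = p + pX * (pX * ('t^ k * Q)))%S /\
    Q 0%N = p 1%N * B 0%N /\ Q 1%N = p 1%N * B 1%N.
Proof.
move=> fE; have f0 : f 0%N = 0 by rewrite fE !jetE.
have f1 : f 1%N = 1 by rewrite fE !jetE.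
set p3 := pshift (pshift (pshift p)).
have pE : p = (pC (p 0%N) + pX * (pC (p 1%N) + pX * (pC (p 2%N) + pX * p3)))%S.
  by rewrite {1}(decomp2 p) {1}(ps_decomp (pshift (pshift p))).
have [|Q' Q'E] := @eqm_factor k.+2 (p3 @@ f)%S p3.
  rewrite -{2}(pcomp_id p3); apply: eqm_comp => // n ltn.
  by rewrite fE padd_coef -!ppowSM coef_tnM ltn addr0.
move: Q'E; rewrite !ppowSM => Q'E.
have pfE : (p @@ f = pC (p 0%N) + f * (pC (p 1%N) + f * (pC (p 2%N) + f * (p3 @@ f))))%S.
  rewrite {1}pE !(pcompD, pcomp_pC, pcomp_XM) //.
exists (pC (p 1%N) * B + pC (p 2%N) * B * (f + pX) +
  B * (f * f + f * pX + pX * pX) * (p3 @@ f) + pX * (pX * (pX * Q')))%S; split.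
  rewrite pfE [X in _ = (X + _)%S]pE Q'E fE; ring.
by rewrite !jetE f0 f1; split; F2ring.
Qed.

(** The last hypothesis says that [e] is the first component of the commutator of (a, f) and (b, g).
    Since [od] obeys the same cocycle law, this one computation serves both the Appell component and
    the u-coordinate. *)
Lemma cocycle_comm_jet m (a : ps) b e f g A B :
  (a = 1 + 't^ m.*2 * A)%S -> a 0%N = 1 -> b 0%N = 1 ->
  (f = pX + pX * (pX * ('t^ m.*2 * B)))%S -> g 0%N = 0 -> g 1%N = 1 ->
  (b * (a @@ g) * (e @@ (f @@ g)) = a * (b @@ f))%S ->
  exists E, (e = 1 + pX * (pX * ('t^ m.*2 * E)))%S /\
    E 0%N = b 1%N * B 0%N + g 2%N * (A 1%N + m%:R * A 0%N) /\
    E 1%N = b 1%N * B 1%N + b 1%N * B 0%N + A 1%N * (g 3%N + m%:R * g 2%N) +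
            a 1%N * (g 2%N * (A 1%N + m%:R * A 0%N)).
Proof.
move=> aE a0 b0 fE g0 g1 eqe.
have f0 : f 0%N = 0 by rewrite fE !jetE.
have f1 : f 1%N = 1 by rewrite fE !jetE.
set h := (f @@ g)%S in eqe.
have h0 : h 0%N = 0 by rewrite /h pcomp_coef0.
have h1 : h 1%N = 1 by rewrite /h pcomp_coef1 // f1 g1 mulr1.
have [Q [QE [Q0 Q1]]] := taylor_jet b fE.
set w := pshift g; set w1 := pshift w.
have wE : w = (1 + pX * w1)%S by rewrite -pC1 -g1 -(ps_decomp w).
have gE : g = (pX * w)%S by exact: series0.
have [|W [WE [W0 W1]]] := @ppow_even_jet w m; first exact: g1.
set A2 := pshift (pshift A).
have AE : A = (pC (A 0%N) + pX * (pC (A 1%N) + pX * A2))%S by exact: decomp2.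
have AgE : (A @@ g = pC (A 0%N) + g * (pC (A 1%N) + g * (A2 @@ g)))%S.
  by rewrite {1}AE !(pcompD, pcomp_pC, pcomp_XM).
have agE : (a @@ g = 1 + 't^ m.*2 * ((1 + pX * (pX * W)) * (A @@ g)))%S.
  by rewrite aE pcompD pcomp1 pcompM // tn_comp // -WE -pmulA.
(* [T] measures how far composition with [g] moves [a]: the sum of [a] and [a @@ g] is
   [t^(2m+2) T]. *)
set T := (pC (A 1%N) * w1 + (w * w * (A2 @@ g) + A2) + W * (A @@ g))%S.
have TE : (A + (1 + pX * (pX * W)) * (A @@ g) = pX * (pX * T))%S.
  have -> : ((1 + pX * (pX * W)) * (A @@ g) = A @@ g + pX * (pX * (W * (A @@ g))))%S by ring.
  rewrite {1}AE /T {1}AgE.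
  have -> : (pX * (pX * (pC (A 1%N) * w1 + (w * w * (A2 @@ g) + A2) + W * (A @@ g))) =
    pC (A 1%N) * pX * (pX * w1) + pX * pX * (w * w * (A2 @@ g) + A2) +
    pX * (pX * (W * (A @@ g))))%S by ring.
  have -> : (pX * w1 = w + 1)%S by rewrite wE; ring.
  rewrite gE; ring.
have T0 : T 0%N = g 2%N * (A 1%N + m%:R * A 0%N).
  rewrite /T !jetE W0 !pcomp_coef0 // -/w wE !jetE -[w1 0%N]/(g 2%N).
  F2ring.
have T1 : T 1%N = A 1%N * (g 3%N + m%:R * g 2%N).
  rewrite /T !jetE W0 W1 !pcomp_coef0 // !pcomp_coef1 // g1 wE !jetE.
  rewrite -[w1 0%N]/(g 2%N) -[w1 1%N]/(g 3%N).
  F2ring.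
set S := (a * Q + b * T)%S.
set u := (b * (a @@ g))%S in eqe.
have u0 : u 0%N = 1 by rewrite /u pmul_coef0 pcomp_coef0 // a0 b0 mulr1.
have u1 : u 1%N = b 1%N + a 1%N.
  by rewrite /u pmul_coef1 pcomp_coef0 // pcomp_coef1 // a0 b0 g1 !mulr1 mul1r addrC.
(* In characteristic 2 the difference of the two sides splits as a (b o f - b) + b (a o g - a),
   which is [t^(2m+2)] times [a Q + b T]. *)
have eS : (u * ((e + 1) @@ h) = 't^ m.*2.+2 * S)%S.
  rewrite pcompD pcomp1.
  have -> : (u * (e @@ h + 1) = u * (e @@ h) + u)%S by ring.
  rewrite eqe QE /u agE !ppowSM /S.
  have -> : (pX * (pX * ('t^ m.*2 * (a * Q + b * T))) =
     a * (pX * (pX * ('t^ m.*2 * Q))) + b * 't^ m.*2 * (pX * (pX * T)))%S by ring.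
  rewrite -TE aE; ring.
have [ui uiE] := inv_ex u0.
(* Dividing by the unit [u] and undoing the composition with [h] transfers the divisibility to
   [e + 1]. *)
have /tn_factor : forall n, (n < m.*2.+2)%N -> (e + 1)%S n = 0.
  apply: (pcomp_small h0 h1) => n ltn.
  have -> : ((e + 1) @@ h = 't^ m.*2.+2 * (ui * S))%S.
    have -> : ((e + 1) @@ h = ui * (u * ((e + 1) @@ h)))%S.
      by rewrite pmulA (pmulC ui) uiE pmul1s.
    by rewrite eS; ring.
  by rewrite coef_tnM ltn.
set E : ps := fun n => _; move=> eE.
exists E; split; first by rewrite -!ppowSM -eE; ring.
move: eS; rewrite eE pcompM // tn_comp //.
(* Composing [t^(2m+2)] with [h] multiplies it by [1 + t^2 Z], which does not touch the two leading
   coefficients. *)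
have [|Z [ZE [_ _]]] := @ppow_even_jet (pshift h) m.+1; first exact: h1.
rewrite doubleS in ZE; rewrite ZE.
have -> : (u * ('t^ m.*2.+2 * (1 + pX * (pX * Z)) * (E @@ h)) =
  't^ m.*2.+2 * (u * (1 + pX * (pX * Z)) * (E @@ h)))%S by ring.
move/tn_inj => eS.
have E0 : E 0%N = S 0%N.
  by rewrite -eS !jetE u0 pcomp_coef0 // mul1r.
have E1 : E 1%N = S 1%N + u 1%N * S 0%N.
  rewrite -eS !jetE u0 pcomp_coef0 // pcomp_coef1 // h1.
  F2ring.
rewrite E1 E0 u1 /S !jetE a0 b0 T0 T1 Q0 Q1; split; first by F2ring.
(* The identity for [E 1] uses that [b 1] is idempotent, hence the case split. *)
by case: (F2P (b 1%N)) => ->; F2ring.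
Qed.

(** * Leading coefficients of commutators *)

(* Here and below [m] stands for n - 1. *)
Definition depth (m : nat) (f : ps) : Prop :=
  [/\ f 0%N = 0, f 1%N = 1, forall k, (k <= m)%N -> ev f k = 0 &
      forall k, (0 < k < m.*2)%N -> od f k = 0].

Lemma depth_od m f : depth m f ->
  (od f = 1 + 't^ m.*2 * (fun n => (od f + 1)%S (m.*2 + n)%N))%S.
Proof.
move=> [f0 f1 _ odf]; rewrite -tn_factor; first by ring.
by case=> [|n] ltn; rewrite padd_coef; [rewrite /od f1 addFF|rewrite odf ?addr0].
Qed.

Lemma depth_ev m f : depth m f ->
  (ev f = 't^ m.+1 * (fun n => ev f (m.+1 + n)%N))%S.
Proof. by move=> [_ _ evf _]; apply: tn_factor => n; rewrite ltnS => /evf. Qed.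

(** Expanding [t u^2 + v^2] gives [B = C^2 + t^(2m-1) A^2]. The square [C^2] has no linear term, and
    [A^2] reaches index 1 only for [m = 1]. *)
Lemma depthE m f A C : (0 < m)%N ->
  (od f = 1 + 't^ m.*2 * A)%S -> (ev f = 't^ m.+1 * C)%S ->
  exists B, (f = pX + pX * (pX * ('t^ m.*2 * B)))%S /\
    B 0%N = C 0%N /\ B 1%N = (m == 1%N)%:R * A 0%N.
Proof.
case: m => // m _ odE evE.
exists (C * C + 't^ m.*2.+1 * (A * A))%S; split; last first.
  rewrite !padd_coef !coef_tnM /= (coef_sq_even _ 0) (coef_sq_odd _ 0) addr0 add0r.
  by case: m {odE evE} => [|m]; rewrite ?(coef_sq_even _ 0) ?mul1r //= mul0r.
rewrite {1}(od_evE f) odE evE.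
have TE : (('t^ m.+2 * 't^ m.+2) = pX * (pX * 't^ m.+1.*2))%S.
  by rewrite -ppowD -!ppowS -addnn !addnS !addSn.
transitivity (pX + pX * ('t^ m.+1.*2 * 't^ m.+1.*2 * (A * A)) +
   't^ m.+2 * 't^ m.+2 * (C * C))%S; first by ring.
rewrite TE; have -> : ('t^ m.+1.*2 * 't^ m.+1.*2 = pX * 't^ m.*2.+1 * 't^ m.+1.*2)%S.
  by rewrite -ppowS.
ring.
Qed.

Lemma ppow_jet1 w k : w 0%N = 1 -> ppow w k 0%N = 1 /\ ppow w k 1%N = k%:R * w 1%N.
Proof.
move=> w0; elim: k => [|k [IH0 IH1]]; first by rewrite mul0r.
by rewrite ppowS !jetE w0 IH0 IH1 -natr1; split; F2ring.
Qed.

(* For n = 2 two otherwise negligible terms, t (u_f - 1)^2 in f and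
   v_g (u_f o g - 1) in v_{f o g}, reach the leading coefficients: they are the
   terms in [m == 1]. *)
Lemma comm_depth m f g c : (0 < m)%N -> depth m f -> g 0%N = 0 -> g 1%N = 1 ->
  c 0%N = 0 -> c 1%N = 1 -> (c @@ (f @@ g) = g @@ f)%S ->
  [/\ depth m.+1 c,
      od c m.*2.+2 = g 3%N * ev f m.+1 + g 2%N * (od f m.*2.+1 + m%:R * od f m.*2),
      od c m.*2.+3 = g 3%N * ((m == 1%N)%:R * od f m.*2) + g 3%N * ev f m.+1 +
         od f m.*2.+1 * (g 3%N + m%:R * g 2%N) &
      ev c m.+2 = ev f m.+1 * (g 3%N + m.+1%:R * g 2%N) +
         (m == 1%N)%:R * (g 2%N * od f m.*2)].
Proof.
move=> m_gt0 df g0 g1 c0 c1 cE; have [f0 f1 _ odf0] := df.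
have := depth_od df; set A : ps := fun n => _; move=> odE.
have := depth_ev df; set C : ps := fun n => _; move=> evE.
have A0 : A 0%N = od f m.*2.
  by rewrite /A addn0 padd_coef /pone; case: m m_gt0 {df odf0 odE evE A C} => // m _; rewrite addr0.
have A1 : A 1%N = od f m.*2.+1 by rewrite /A addn1 padd_coef addr0.
have C0 : C 0%N = ev f m.+1 by rewrite /C addn0.
have [B [fE [B0 B1]]] := depthE m_gt0 odE evE.
have fg0 : (f @@ g)%S 0%N = 0 by rewrite pcomp_coef0.
have fg1 : (f @@ g)%S 1%N = 1 by rewrite pcomp_coef1 // f1 g1 mulr1.
(* Taking u-coordinates of [cE] yields the cocycle equation of a commutator. *)
have odc : (od g * (od f @@ g) * (od c @@ (f @@ g)) = od f * (od g @@ f))%S.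
  have := congr1 od cE; rewrite !od_comp // => odcE.
  by rewrite (pmulC (od f)) -odcE; ring.
have [] := cocycle_comm_jet odE f1 g1 fE g0 g1 odc.
have -> : od f 1%N = 0 by apply: odf0; rewrite /= -[2%N]/(1.*2) leq_double.
rewrite mul0r addr0 B0 B1 A0 A1 C0 -[od g 1%N]/(g 3%N) => E [odcE [E0 E1]].
have odc_coef k : od c (m.*2.+2 + k)%N = E k.
  by rewrite odcE padd_coef -!ppowSM coef_tnM ltnNge leq_addr addKn add0r.
have odc_small k : (0 < k < m.+1.*2)%N -> od c k = 0.
  case/andP; case: k => // k _ ltk.
  by rewrite odcE padd_coef -!ppowSM coef_tnM -doubleS ltk addr0.
have [Qo [QoE _]] := taylor_jet (od g) fE.
have [Qv [QvE _]] := taylor_jet (ev g) fE.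
set h := (f @@ g)%S in cE fg0 fg1 odc *.
set A' := (ppow (pshift g) m.*2 * (A @@ g))%S.
have odfgE : (od f @@ g = 1 + 't^ m.*2 * A')%S.
  by rewrite odE pcompD pcomp1 pcompM // tn_comp // /A' pmulA.
set W := ppow (pshift g) m.+1.
have evfgE : (ev f @@ g = 't^ m.+1 * (W * (C @@ g)))%S.
  by rewrite evE pcompM // tn_comp // -pmulA.
have odchE : exists E', (od c @@ h = 1 + 't^ m.*2.+2 * E')%S.
  by rewrite odcE -!ppowSM pcompD pcomp1 pcompM // tn_comp // -pmulA; eexists.
have [E' {}odchE] := odchE.
have evgE : ev g = (pX * pshift (ev g))%S by apply: series0.
(* The v-coordinates of the two sides of [cE] are compared modulo [t^(2m+2)]; [Z] collects the
   rest. *)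
have evcE : exists Z, (ev c @@ h = 't^ m.+1 * (C * od g + W * (C @@ g)) +
    't^ m.*2.+1 * (pshift (ev g) * A') + 't^ m.*2.+2 * Z)%S.
  have := congr1 ev cE; rewrite ev_comp // (ev_comp _ f0) {1}/h ev_comp //.
  rewrite odchE QoE QvE odfgE evfgE evE -!ppowSM => evcE.
  eexists.
  transitivity (('t^ m.+1 * C * (od g + 't^ m.*2.+2 * Qo) +
    (ev g + 't^ m.*2.+2 * Qv)) + (ev g * (1 + 't^ m.*2 * A') +
     't^ m.+1 * (W * (C @@ g))) * (1 + 't^ m.*2.+2 * E'))%S.
    by rewrite -evcE; ring.
  have -> : ('t^ m.*2.+1 * (pshift (ev g) * A') = ev g * 't^ m.*2 * A')%S.
    by rewrite evgE pshiftXM ppowSM; ring.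
  instantiate (1 := ('t^ m.+1 * C * Qo + Qv + (ev g * (1 + 't^ m.*2 * A') +
     't^ m.+1 * (W * (C @@ g))) * E')%S).
  ring.
have [Z {}evcE] := evcE.
have [W0 W1] := @ppow_jet1 (pshift g) m.+1 g1; rewrite -/W in W0 W1.
(* At index [m+1] the leading coefficient of [ev f] occurs twice and cancels, so the depth
   increases. *)
have evch0 k : (k <= m.+1)%N -> (ev c @@ h)%S k = 0.
  move=> lek; rewrite evcE !padd_coef !coef_tnM.
  have lt2 : (k < m.*2.+1)%N.
    by rewrite ltnS (leq_trans lek) // -addnn -add1n leq_add2r.
  rewrite lt2 (leqW lt2) !addr0; move: lek; rewrite leq_eqVlt.
  case/predU1P=> [->|->//]; rewrite ltnn subnn !jetE pcomp_coef0 // W0 -[od g 0%N]/(g 1%N) g1.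
  by rewrite mulr1 mul1r addFF.
have evc0 k : (k <= m.+1)%N -> ev c k = 0.
  by move=> lek; exact: (@pcomp_small (ev c) h m.+2 fg0 fg1 evch0 k lek).
split.
- by split.
- by rewrite -[in LHS](addn0 m.*2.+2) odc_coef E0.
- by rewrite -[in LHS](addn1 m.*2.+2) odc_coef E1.
rewrite -(@pcomp_lead (ev c) h) // evcE !padd_coef !coef_tnM.
have [|_] := ltnP m.+2 m.+1; first by rewrite ltnNge leqnSn.
rewrite subSnn !jetE pcomp_coef0 // pcomp_coef1 // W0 W1 g1 C0.
rewrite -[od g 1%N]/(g 3%N) -[od g 0%N]/(g 1%N) g1 -[pshift g 1%N]/(g 2%N).
rewrite (_ : (m.+2 < m.*2.+2)%N); last by rewrite !ltnS -addnn -add1n leq_add2r.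
have A'0 : A' 0%N = od f m.*2.
  by rewrite /A' pmul_coef0 pcomp_coef0 // A0 (ppow_jet1 _ g1).1 mul1r.
(* The term starting at [t^(2m+1)] reaches index [m+2] exactly when [m = 1]. *)
have -> : (m.+2 < m.*2.+1)%N = (m != 1%N).
  by rewrite ltnS -addnn -[m.+2]/(2 + m)%N leq_add2r ltn_neqAle m_gt0 andbT eq_sym.
case: eqP => [m1|_] /=; last by rewrite mul0r; F2ring.
rewrite [(m.+2 - m.*2.+1)%N](_ : _ = 0%N); last by rewrite m1.
rewrite pmul_coef0 A'0 -[pshift (ev g) 0%N]/(g 2%N) !mul1r !mulr1.
by F2ring.
Qed.

(** Since [g] agrees with t modulo [t^4], composition with it does not disturb the leading
    coefficients. The product of the two u-tails starts [2m] places higher; for [m = 1] it gives the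
    bilinear term in the coefficient of index 5. *)
Lemma depth_comp m f g : (0 < m)%N -> depth m f -> depth m g ->
  [/\ depth m (f @@ g)%S,
      forall i, (i < 2)%N -> ev (f @@ g)%S (m.+1 + i)%N =
         ev f (m.+1 + i)%N + ev g (m.+1 + i)%N,
      forall i, (i < 4)%N -> (i < m.*2)%N ->
        od (f @@ g)%S (m.*2 + i)%N = od f (m.*2 + i)%N + od g (m.*2 + i)%N &
      m = 1%N -> od (f @@ g)%S 5%N =
        od f 5%N + od g 5%N + (od f 2%N * od g 3%N + od f 3%N * od g 2%N)].
Proof.
move=> m_gt0 df dg; have [f0 f1 _ _] := df; have [g0 g1 evg odg] := dg.
have := depth_od df; set A : ps := fun n => _; move=> odfE.
have := depth_ev df; set C : ps := fun n => _; move=> evfE.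
have := depth_od dg; set A' : ps := fun n => _; move=> odgE.
have := depth_ev dg; set C' : ps := fun n => _; move=> evgE.
have m2_gt1 : (1 < m.*2)%N by rewrite -[2%N]/(1.*2) leq_double.
have AE (i : nat) : A i = od f (m.*2 + i)%N.
  by rewrite /A padd_coef /pone addn_eq0 double_eq0 -leqn0 leqNgt m_gt0 addr0.
have A'E (i : nat) : A' i = od g (m.*2 + i)%N.
  by rewrite /A' padd_coef /pone addn_eq0 double_eq0 -leqn0 leqNgt m_gt0 addr0.
have [B [gE _]] := depthE m_gt0 odgE evgE.
have gX : eqm 4 g pX.
  move=> n ltn; rewrite gE padd_coef -!ppowSM coef_tnM.
  by rewrite (leq_trans ltn) ?addr0 // !ltnS.
have g2 : pshift g 1%N = 0 by apply: (gX 2%N).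
(* A square has no odd-degree terms, and its coefficient of index 2 is that of index 1 of
   [pshift g], which is zero. *)
have WE k : eqm 4 (ppow (pshift g) k.*2) 1%S.
  rewrite ppow_double; elim: k => // k IH; rewrite ppowS.
  rewrite -[X in eqm _ _ X]pmul1s; apply: eqmM => // n.
  case: n => [|[|[|[|n]]]] // _.
  - by rewrite pmul_coef0 mulFF.
  - by rewrite (coef_sq_odd _ 0).
  - by rewrite (coef_sq_even _ 1).
  - by rewrite (coef_sq_odd _ 1).
set Y := (ppow (pshift g) m.*2 * (A @@ g))%S.
have YE : eqm 4 Y A.
  rewrite -[X in eqm _ _ X]pmul1s; apply: eqmM => //.
  by rewrite -[X in eqm _ _ X]pcomp_id; apply: eqm_comp.
have odfgE : (od f @@ g = 1 + 't^ m.*2 * Y)%S.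
  by rewrite odfE pcompD pcomp1 pcompM // tn_comp // -pmulA.
have odE : (od (f @@ g) = 1 + 't^ m.*2 * (Y + A' + 't^ m.*2 * (Y * A')))%S.
  by rewrite od_comp // odfgE odgE; ring.
set W := ppow (pshift g) m.+1.
have evE : (ev (f @@ g) = 't^ m.+1 * (C' + W * (C @@ g) + 't^ m.*2 * (C' * Y)))%S.
  rewrite ev_comp // odfgE evfE evgE pcompM // tn_comp // -/W; ring.
have od_coef i : od (f @@ g)%S (m.*2 + i)%N = (Y + A' + 't^ m.*2 * (Y * A'))%S i.
  rewrite odE padd_coef coef_tnM ltnNge leq_addr addKn.
  by rewrite /pone addn_eq0 double_eq0 -leqn0 leqNgt m_gt0 add0r.
split.
- split.
  + by rewrite pcomp_coef0.
  + by rewrite pcomp_coef1 // f1 g1 mulr1.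
  + by move=> k lek; rewrite evE coef_tnM ltnS lek.
  + by case=> // k /andP[_ ltk]; rewrite odE padd_coef coef_tnM ltk addr0.
- have [W0 W1] := @ppow_jet1 (pshift g) m.+1 g1; rewrite -/W g2 mulr0 in W0 W1.
  move=> i lti; rewrite evE coef_tnM ltnNge leq_addr addKn !padd_coef coef_tnM.
  rewrite (leq_trans lti m2_gt1) addr0 addrC -/(C i) -/(C' i); congr (_ + _).
  case: i lti => [|[|i]] // _; rewrite !jetE W0 pcomp_coef0 // ?mul1r //.
  by rewrite W1 pcomp_coef1 // g1; F2ring.
- move=> i lti4 ltim; rewrite od_coef !padd_coef coef_tnM ltim addr0.
  by rewrite YE // AE A'E.
- move=> m1; rewrite {1}(_ : 5%N = (m.*2 + 3)%N); last by rewrite m1.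
  rewrite od_coef !padd_coef coef_tnM YE // AE A'E m1 /= -[(3 - 1.*2)%N]/1%N.
  by rewrite pmul_coef1 !YE // !AE !A'E m1; F2ring.
Qed.

Lemma mul_comp_coef m (a : ps) b f : (0 < m)%N -> f 0%N = 0 -> f 1%N = 1 ->
  a 0%N = 1 -> b 0%N = 1 -> (forall k, (0 < k < m.*2)%N -> a k = 0) ->
  (forall k, (0 < k < m.*2)%N -> b k = 0) ->
  (forall k, (0 < k < m.*2)%N -> (a * (b @@ f))%S k = 0) /\
  forall i, (i < 2)%N -> (a * (b @@ f))%S (m.*2 + i)%N = a (m.*2 + i)%N + b (m.*2 + i)%N.
Proof.
move=> m_gt0 f0 f1 a0 b0 asm bsm.
have m2_gt1 : (1 < m.*2)%N by rewrite -[2%N]/(1.*2) leq_double.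
have fac c : c 0%N = 1 -> (forall k, (0 < k < m.*2)%N -> c k = 0) ->
    (c = 1 + 't^ m.*2 * (fun i => c (m.*2 + i)%N))%S.
  move=> c0 csm; apply: psP => k; rewrite padd_coef coef_tnM; case: ltnP => [ltk|lek].
    by rewrite addr0; case: k ltk => [|k] ltk; rewrite ?c0 // csm.
  rewrite subnKC // /pone -leqn0 leqNgt (leq_trans _ lek) ?add0r //.
  exact: ltnW.
have := fac a a0 asm; set A : ps := fun i => _; move=> aE.
have := fac b b0 bsm; set B : ps := fun i => _; move=> bE.
have [|W [WE _]] := @ppow_even_jet (pshift f) m; first exact: f1.
have abE : (a * (b @@ f) = 1 + 't^ m.*2 * (A + (1 + pX * (pX * W)) * (B @@ f) +
    't^ m.*2 * (A * ((1 + pX * (pX * W)) * (B @@ f)))))%S.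
  by rewrite {1}aE {1}bE pcompD pcomp1 pcompM // tn_comp // WE; ring.
rewrite abE; split=> [[|k] // /andP[_ ltk]|i lti].
  by rewrite padd_coef coef_tnM ltk addr0.
rewrite padd_coef coef_tnM ltnNge leq_addr addKn.
rewrite /pone addn_eq0 double_eq0 -leqn0 leqNgt m_gt0 add0r !padd_coef.
rewrite coef_tnM (leq_trans lti m2_gt1) addr0; congr (_ + _).
case: i lti => [|[|i]] // _; rewrite !jetE.
  by rewrite pcomp_coef0.
by rewrite pcomp_coef1 // f1 mulr1.
Qed.

(** * The candidate terms and their quotients *)

Implicit Types (x y z : RR) (m : nat) (S K : RR -> Prop).

(** With n = m + 1, odd [m] is the case of even n, and the factor [(m == 1)] singles out n = 2. The
    guard [0 < m] leaves the whole group at [m = 0]. *)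
Definition lead_rel m f : Prop :=
  if odd m then od f m.*2 = ev f m.+1 /\ od f m.*2.+1 = (m == 1%N)%:R * ev f m.+1
  else (0 < m)%N -> od f m.*2.+1 = ev f m.+1.

(* [Gam m] is the explicit description of [gamma Rg m.+1]. *)
Definition Gam m x : Prop :=
  [/\ x.1 0%N = 1, depth m x.2, lead_rel m x.2 &
      forall k, (0 < k < m.*2)%N -> x.1 k = 0].

Lemma Gam0 x : Gam 0 x <-> isR x.
Proof.
split=> [[x10 [f0 f1 _ _] _ _]//|[x10 [f0 f1]]].
by split=> [//| |//|[]//]; split=> // -[].
Qed.

Lemma Gam_isR m x : Gam m x -> isR x.
Proof. by case=> x10 [f0 f1 _ _] _ _. Qed.

(** The coefficients free on [Gam m] that must vanish on [Gam m.+1]. Those determined by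
    [lead_rel m] are left out, and the sums of an [od] and an [ev] entry encode [lead_rel m.+1]. *)
Definition coords m x : seq 'F_2 :=
  if odd m then [:: ev x.2 m.+1; od x.2 m.*2.+3 + ev x.2 m.+2; x.1 m.*2; x.1 m.*2.+1]
  else [:: ev x.2 m.+1; od x.2 m.*2; od x.2 m.*2.+2 + ev x.2 m.+2; od x.2 m.*2.+3;
           x.1 m.*2; x.1 m.*2.+1].

Lemma coords_mul m x y i : (0 < m)%N -> Gam m x -> Gam m y ->
  nth 0 (coords m (rmul x y)) i = nth 0 (coords m x) i + nth 0 (coords m y) i.
Proof.
move=> m_gt0 [x10 dx rx xsm] [y10 dy ry ysm].
have [f0 f1 _ _] := dx.
have [_ ab] := mul_comp_coef m_gt0 f0 f1 x10 y10 xsm ysm.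
have := ab 0%N isT; have := ab 1%N isT; rewrite !addn0 !addn1 => {}ab1 ab0.
have [_ evE odE od1] := depth_comp m_gt0 dy dx.
have := evE 0%N isT; have := evE 1%N isT; rewrite !addn0 !addn1 => ev1 ev0 {evE}.
have m2 : (1 < m.*2)%N by rewrite -[2%N]/(1.*2) leq_double.
have od0 := odE 0%N isT (ltnW m2); rewrite addn0 in od0.
have od3 : od (y.2 @@ x.2)%S m.*2.+3 = od y.2 m.*2.+3 + od x.2 m.*2.+3.
  have [m_gt1|] := ltnP 1 m.
    have := odE 3%N isT; rewrite !addn3; apply.
    by rewrite (@leq_trans 2.*2) // leq_double.
  (* For [m = 1] the bilinear correction cancels, because [lead_rel] makes the coefficients of index
     2 and 3 equal in each factor. *)
  move=> m_le1; have m1 : m = 1%N by apply/eqP; rewrite eqn_leq m_le1.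
  move: rx ry; rewrite /lead_rel m1 /= !mul1r => -[r2 r3] [s2 s3].
  by rewrite (od1 m1) r2 r3 s2 s3; F2ring.
rewrite /coords /=; case: ifP => odd_m.
  by case: i => [|[|[|[|i]]]] /=; rewrite ?ev0 ?od3 ?ev1 ?ab0 ?ab1 ?nth_nil; F2ring.
have m_gt1 : (1 < m)%N by rewrite ltn_neqAle m_gt0 andbT; apply: contraFneq odd_m => <-.
have := odE 2%N isT; rewrite !addn2 => od2.
rewrite {}od2; last by rewrite (@leq_trans 2.*2) // leq_double.
by case: i => [|[|[|[|[|[|i]]]]]] /=; rewrite ?od0 ?ev0 ?od3 ?ev1 ?ab0 ?ab1 ?nth_nil; F2ring.
Qed.

Lemma coords_ker m x : (0 < m)%N -> Gam m x ->
  (forall i, nth 0 (coords m x) i = 0) <-> Gam m.+1 x.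
Proof.
move=> m_gt0 [x10 [f0 f1 evf odf] rx xsm]; rewrite /coords /lead_rel.
have ltE k : (k < m.+1.*2)%N -> [|| (k < m.*2)%N, k == m.*2 | k == m.*2.+1].
  by rewrite doubleS ltnS leq_eqVlt ltnS leq_eqVlt orbC orbA [(k < _)%N || _]orbC.
split.
- move=> x0; split=> //.
  + split=> // k.
      rewrite leq_eqVlt ltnS => /predU1P[->|/evf//].
      by move: (x0 0%N); case: ifP.
    case: k => // k /andP[_ /ltE/or3P[ltk|/eqP->|/eqP->]].
    * exact: odf.
    * move: rx x0; rewrite /lead_rel; case: ifP => _ rx x0; last exact: (x0 1%N).
      by rewrite rx.1; apply: (x0 0%N).
    * move: rx x0; rewrite /lead_rel; case: ifP => _ rx x0.
        by rewrite rx.2 [ev _ _](x0 0%N) mulr0.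
      by rewrite rx // [LHS](x0 0%N).
  + move: x0; rewrite /lead_rel /=; case: ifP => _ x0.
      by move=> _; apply: addF_eq0; apply: (x0 1%N).
    split; first by apply: addF_eq0; apply: (x0 2%N).
    by rewrite [LHS](x0 3%N) eqSS -leqn0 leqNgt m_gt0 mul0r.
  + case=> // k /andP[_ /ltE/or3P[ltk|/eqP->|/eqP->]]; first exact: xsm.
      by move: x0; case: ifP => _ x0; [apply: (x0 2%N)|apply: (x0 4%N)].
    by move: x0; case: ifP => _ x0; [apply: (x0 3%N)|apply: (x0 5%N)].
move=> [_ [_ _ ev0 od0]]; rewrite /lead_rel /=.
have lt2 : (m.*2 < m.+1.*2)%N by rewrite doubleS ltnS leqnSn.
have lt3 : (m.*2.+1 < m.+1.*2)%N by rewrite doubleS.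
have m20 : (0 < m.*2)%N by rewrite double_gt0.
case: (odd m) => /= rel x0 i.
  case: i => [|[|[|[|i]]]] /=; rewrite ?nth_nil //.
  - exact: ev0.
  - by rewrite (rel isT) addFF.
  - by rewrite x0 ?m20.
  - by rewrite x0.
case: i => [|[|[|[|[|[|i]]]]]] /=; rewrite ?nth_nil //.
- exact: ev0.
- by rewrite od0 ?m20.
- by rewrite rel.1 addFF.
- by rewrite [LHS]rel.2 eqSS -leqn0 leqNgt m_gt0 mul0r.
- by rewrite x0 ?m20.
- by rewrite x0.
Qed.

(* 1 + t^N (s_0 + s_1 t + ...) *)
Definition unit_tail N (s : seq 'F_2) : ps :=
  fun k => if k == 0%N then 1 else if (k < N)%N then 0 else nth 0 s (k - N).
Definition tail N (s : seq 'F_2) : ps :=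
  fun k => if (k < N)%N then 0 else nth 0 s (k - N).
Definition odev (p q : ps) : ps := (pX * (p * p) + q * q)%S.

Lemma unit_tail_coef m (s : seq 'F_2) : (0 < m)%N ->
  (unit_tail m.*2 s m.*2 = s`_0) * (unit_tail m.*2 s m.*2.+1 = s`_1) *
  (unit_tail m.*2 s m.*2.+2 = s`_2) * (unit_tail m.*2 s m.*2.+3 = s`_3).
Proof.
move=> m_gt0; have E i : unit_tail m.*2 s (m.*2 + i)%N = s`_i.
  by rewrite /unit_tail addn_eq0 double_eq0 -leqn0 leqNgt m_gt0 ltnNge leq_addr addKn.
by rewrite -!E addn0 addn1 addn2 addn3.
Qed.

Lemma tail_coef m (s : seq 'F_2) :
  (tail m.+1 s m.+1 = s`_0) * (tail m.+1 s m.+2 = s`_1).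
Proof.
have E i : tail m.+1 s (m.+1 + i)%N = s`_i by rewrite /tail ltnNge leq_addr addKn.
by rewrite -!E addn0 addn1.
Qed.

Lemma depth_odev m (s r : seq 'F_2) : depth m (odev (unit_tail m.*2 s) (tail m.+1 r)).
Proof.
split.
- by rewrite -[LHS]/(ev _ 0%N) ev_unique.
- by rewrite -[LHS]/(od _ 0%N) od_unique.
- by move=> k lek; rewrite ev_unique /tail ltnS lek.
- by case=> // k /andP[_ ltk]; rewrite od_unique /unit_tail ltk.
Qed.

Lemma Gam_odev m (s r g : seq 'F_2) : (0 < m)%N ->
  (if odd m then nth 0 s 0 = nth 0 r 0 /\ nth 0 s 1 = (m == 1%N)%:R * nth 0 r 0
   else nth 0 s 1 = nth 0 r 0) ->
  Gam m (unit_tail m.*2 g, odev (unit_tail m.*2 s) (tail m.+1 r)).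
Proof.
move=> m_gt0 rel; split=> //=; first exact: depth_odev.
  rewrite /lead_rel od_unique ev_unique !unit_tail_coef // !tail_coef.
  by case: (odd m) rel.
by case=> // k /andP[_ ltk]; rewrite /unit_tail ltk.
Qed.

Lemma coords_surj m (h : nat -> 'F_2) : (0 < m)%N -> exists2 x, Gam m x &
  forall i, (i < size (coords m x))%N -> nth 0 (coords m x) i = h i.
Proof.
move=> m_gt0; case odd_m: (odd m).
  (* The first two entries of the u-tail are dictated by [lead_rel]; with [ev] zero at [m+2], the
     last entry alone realizes coordinate 1. *)
  exists (unit_tail m.*2 [:: h 2%N; h 3%N],
    odev (unit_tail m.*2 [:: h 0%N; (m == 1%N)%:R * h 0%N; 0; h 1%N]) (tail m.+1 [:: h 0%N])).
    by apply: Gam_odev; rewrite ?odd_m.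
  rewrite /coords odd_m /= od_unique ev_unique !tail_coef.
  rewrite !unit_tail_coef //= addr0.
  by case=> [|[|[|[|]]]].
exists (unit_tail m.*2 [:: h 4%N; h 5%N],
  odev (unit_tail m.*2 [:: h 1%N; h 0%N; h 2%N; h 3%N]) (tail m.+1 [:: h 0%N])).
  by apply: Gam_odev; rewrite ?odd_m.
rewrite /coords odd_m /= od_unique ev_unique !tail_coef.
rewrite !unit_tail_coef //= addr0.
by case=> [|[|[|[|[|[|]]]]]].
Qed.

Definition phi k m x : 'rV['Z_2]_k := \row_(i < k) nth 0 (coords m x) i.

Lemma size_coords m x : size (coords m x) = if odd m then 4%N else 6%N.
Proof. by rewrite /coords; case: ifP. Qed.

Lemma phi_quot_iso k m : (0 < m)%N -> k = (if odd m then 4%N else 6%N) ->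
  quot_iso (Gam m) (Gam m.+1) (phi k m).
Proof.
move=> m_gt0 kE; split.
- by move=> x y Gx Gy; apply/rowP => i; rewrite !mxE coords_mul.
- move=> h; have [x Gx xh] := @coords_surj m (fun i => if insub i is Some j then h 0 j else 0) m_gt0.
  exists x; split=> //; apply/rowP => i; rewrite mxE xh ?size_coords -?kE //.
  by rewrite insubT //= => lti; congr (h 0 _); apply: val_inj.
- move=> x Gx; rewrite -coords_ker //; split=> [x0 i|x0]; last first.
    by apply/rowP => i; rewrite !mxE x0.
  have [lti|gei] := ltnP i k; last by rewrite nth_default // size_coords -kE.
  by have /rowP/(_ (Ordinal lti)) := x0; rewrite !mxE.
Qed.

(** * The abelianization *)

(** The cross term of [g^2] is even, so [p 2] does not contribute to the coefficient of index 3. *)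
Lemma pcomp_coef23 p g : g 0%N = 0 -> g 1%N = 1 ->
  (p @@ g)%S 2%N = p 1%N * g 2%N + p 2%N /\ (p @@ g)%S 3%N = p 1%N * g 3%N + p 3%N.
Proof.
move=> g0 g1; set p3 := pshift (pshift (pshift p)).
have pE : p = (pC (p 0%N) + pX * (pC (p 1%N) + pX * (pC (p 2%N) + pX * p3)))%S.
  by rewrite {1}(decomp2 p) {1}(ps_decomp (pshift (pshift p))).
have -> : (p @@ g = pC (p 0%N) + g * (pC (p 1%N) + g * (pC (p 2%N) + g * (p3 @@ g))))%S.
  by rewrite {1}pE !(pcompD, pcomp_pC, pcomp_XM).
rewrite !(padd_coef, pmul_coef3, pmul_coef2, pmul_coef1, pmul_coef0).
rewrite pcomp_coef0 // g0 g1 /pC /= -[p3 0%N]/(p 3%N).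
by split; F2ring.
Qed.

Lemma pcomp_low f g : f 0%N = 0 -> f 1%N = 1 -> g 0%N = 0 -> g 1%N = 1 ->
  [/\ od (f @@ g)%S 1%N = od f 1%N + od g 1%N,
      od (f @@ g)%S 2%N = od f 2%N + od g 2%N + od f 1%N * ev g 1%N + od f 1%N * od g 1%N,
      od (f @@ g)%S 3%N = od f 3%N + od g 3%N + od f 1%N * od g 1%N +
        (od f 1%N * ev g 1%N + od f 2%N) * od g 1%N + od f 1%N * od g 2%N,
      ev (f @@ g)%S 1%N = ev f 1%N + ev g 1%N &
      ev (f @@ g)%S 2%N = ev f 2%N + ev g 2%N + ev g 1%N * od f 1%N + ev f 1%N * ev g 1%N].
Proof.
move=> f0 f1 g0 g1; have [o2 o3] := pcomp_coef23 (od f) g0 g1.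
have [e2 e3] := pcomp_coef23 (ev f) g0 g1.
have o0 : od f 0%N = 1 by []; have o0' : od g 0%N = 1 by [].
have e0' : ev g 0%N = 0 by [].
rewrite od_comp // ev_comp // !padd_coef !pmul_coef1 !pmul_coef2 !pmul_coef3.
rewrite !pcomp_coef0 // !pcomp_coef1 // o2 o3 e2 g1 o0 o0' e0'.
rewrite -[g 2%N]/(ev g 1%N) -[g 3%N]/(od g 1%N).
by split; F2ring.
Qed.

Definition F2_to_Z4 (a : 'F_2) : 'Z_4 := (a : nat)%:R.

(* Composition perturbs the sums of coefficients by quadratic terms; the lift to
   Z/4 and the products [od f 1 * od f 2] absorb them. *)
Definition zeta_quad (f : ps) : 'F_2 := ev f 2%N + od f 3%N + od f 1%N * od f 2%N.
Definition zeta (f : ps) : 'Z_4 :=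
  F2_to_Z4 (ev f 1%N) - F2_to_Z4 (od f 1%N) + 2%:R * F2_to_Z4 (zeta_quad f).
Definition eta (f : ps) : 'F_2 := od f 2%N + od f 3%N + od f 1%N * od f 2%N.

(** Lifting a sum of bits a + a' to Z/4 costs a carry 2aa'. The carries of [ev 1] and [od 1] match
    the bilinear defect [qE] of [zeta_quad]. *)
Lemma zeta_comp f g : f 0%N = 0 -> f 1%N = 1 -> g 0%N = 0 -> g 1%N = 1 ->
  zeta (f @@ g)%S = zeta f + zeta g.
Proof.
move=> f0 f1 g0 g1; have [o1 o2 o3 e1 e2] := pcomp_low f0 f1 g0 g1.
have qE : zeta_quad (f @@ g)%S = zeta_quad f + zeta_quad g + (ev f 1%N * ev g 1%N + od f 1%N * od g 1%N).
  rewrite /zeta_quad o1 o2 o3 e2.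
  by case: (F2P (od f 1%N)) => ->; case: (F2P (od g 1%N)) => ->; F2ring.
rewrite /zeta qE o1 e1.
move: (ev f 1%N) (od f 1%N) (ev g 1%N) (od g 1%N) (zeta_quad f) (zeta_quad g) => a b a' b' q q'.
case: (F2P a) => ->; case: (F2P b) => ->; case: (F2P a') => ->; case: (F2P b') => ->;
  case: (F2P q) => ->; case: (F2P q') => ->; exact: val_inj.
Qed.

Lemma eta_comp f g : f 0%N = 0 -> f 1%N = 1 -> g 0%N = 0 -> g 1%N = 1 ->
  eta (f @@ g)%S = eta f + eta g.
Proof.
move=> f0 f1 g0 g1; have [o1 o2 o3 e1 e2] := pcomp_low f0 f1 g0 g1.
rewrite /eta o1 o2 o3.
by case: (F2P (od f 1%N)) => ->; case: (F2P (od g 1%N)) => ->; F2ring.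
Qed.

(** The coordinates are arranged so that the four generators of the presentation map to the standard
    basis. *)
Definition phi1 x : ('Z_2 * 'Z_4 * 'Z_2 * 'Z_2)%type :=
  (x.1 1%N, zeta x.2, od x.2 1%N, eta x.2).

Lemma phi1_mul x y : isR x -> isR y -> phi1 (rmul x y) = phi1 x + phi1 y.
Proof.
move=> [x10 [x20 x21]] [y10 [y20 y21]]; rewrite /phi1 /=.
rewrite zeta_comp // eta_comp // addrC (addrC (eta _)).
have [-> _ _ _ _] := pcomp_low y20 y21 x20 x21.
rewrite pmul_coef1 pcomp_coef0 // pcomp_coef1 // x10 x21 y10 mul1r !mulr1.
by rewrite [X in (X, _, _, _)]addrC (addrC (od y.2 1%N)).
Qed.

Lemma phi1_ker x : isR x -> phi1 x = 0 <-> Gam 1 x.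
Proof.
move=> [x10 [x20 x21]]; split.
  move=> e; have a1 : x.1 1%N = 0 := congr1 (fun t => t.1.1.1) e.
  have u1 : od x.2 1%N = 0 := congr1 (fun t => t.1.2) e.
  have z : zeta x.2 = 0 := congr1 (fun t => t.1.1.2) e.
  have h : eta x.2 = 0 := congr1 (fun t => t.2) e.
  move: z h; rewrite /zeta /zeta_quad /eta u1 !mul0r !addr0 => z h.
  (* Once [od x.2 1] is zero, [zeta] has binary digits [ev x.2 1] and [zeta_quad], and both
     vanish. *)
  have [v1 q] : ev x.2 1%N = 0 /\ ev x.2 2%N + od x.2 3%N = 0.
    move: z; case: (F2P (ev x.2 1%N)) => ->; case: (F2P (ev x.2 2%N + od x.2 3%N)) => -> //;
    by move=> /(congr1 val).
  split=> //.
  - split=> //; first by case=> [|[|k]].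
    by case=> [|[|k]].
  - rewrite /lead_rel /= mul1r; split; last by rewrite (addF_eq0 q).
    by rewrite (addF_eq0 h) (addF_eq0 q).
  - by case=> [|[|k]].
case=> _ [_ _ ev0 od0] [/= o2 o3] x0; rewrite /phi1 /zeta /eta /zeta_quad.
rewrite mul1r in o3; rewrite (x0 1%N) // (ev0 1%N) // (od0 1%N) // o2 o3 !mul0r !addr0.
by rewrite addFF; congr (_, _, _, _); apply: val_inj.
Qed.

Lemma zeta_onto (z : 'Z_4) (b : 'F_2) :
  exists a q : 'F_2, F2_to_Z4 a - F2_to_Z4 b + 2%:R * F2_to_Z4 q = z.
Proof.
case: (F2P b) => ->; case: z => [[|[|[|[|k]]]] ltk] //.
- by exists 0, 0; apply: val_inj.
- by exists 1, 0; apply: val_inj.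
- by exists 0, 1; apply: val_inj.
- by exists 1, 1; apply: val_inj.
- by exists 1, 0; apply: val_inj.
- by exists 0, 1; apply: val_inj.
- by exists 1, 1; apply: val_inj.
- by exists 0, 0; apply: val_inj.
Qed.

Lemma phi1_quot_iso : quot_iso Rg (Gam 1) phi1.
Proof.
split; [exact: phi1_mul| |exact: phi1_ker].
case=> -[[h0 h1] h2] h3; have [a [q aq]] := zeta_onto h1 h2.
(* With [od] equal to h2, 0, h3 at 1, 2, 3, [eta] is h3; adding h3 to [ev] at 2 makes [zeta_quad]
   equal to q. *)
exists (unit_tail 1 [:: h0], odev (unit_tail 1 [:: h2; 0; h3]) (tail 1 [:: a; q + h3])); split.
  split=> //; split=> /=; first by rewrite -[LHS]/(ev _ 0%N) ev_unique.
  by rewrite -[LHS]/(od _ 0%N) od_unique.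
rewrite /phi1 /zeta /zeta_quad /eta /= !od_unique !ev_unique /unit_tail /tail /=.
have -> : q + h3 + h3 + h2 * 0 = q by F2ring.
have -> : 0 + h3 + h2 * 0 = h3 by F2ring.
by rewrite aq.
Qed.

Lemma phi1_ael : phi1 ael = (1, 0, 0, 0).
Proof. by congr (_, _, _, _); apply: val_inj. Qed.

Lemma phi1_bel1 : phi1 (bel 1) = (0, 1, 0, 0).
Proof. by congr (_, _, _, _); apply: val_inj. Qed.

Lemma phi1_bel12 : phi1 (rmul (bel 1) (bel 2)) = (0, 0, 1, 0).
Proof.
rewrite phi1_mul //.
by congr (_, _, _, _); apply: val_inj.
Qed.

Lemma phi1_bel4 : phi1 (bel 4) = (0, 0, 0, 1).
Proof. by congr (_, _, _, _); apply: val_inj. Qed.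

Definition phi1_row x : ('rV['Z_2]_3 * 'Z_4)%type :=
  let: (a, b, c, d) := phi1 x in (\row_(i < 3) [:: a; c; d]`_i, b).

Lemma phi1_row_quot_iso : quot_iso Rg (Gam 1) phi1_row.
Proof.
have [phiM phi_onto phi_ker] := phi1_quot_iso; split.
- move=> x y Rx Ry; rewrite /phi1_row phiM //.
  case: (phi1 x) (phi1 y) => [[[a b] c] d] [[[a' b'] c'] d'] /=.
  congr (_, _); apply/rowP => i; rewrite !mxE.
  by case: i => [[|[|[|]]]].
- case=> h b; have [x [Rx phix]] := phi_onto (h 0 0, b, h 0 1, h 0 2%:R).
  exists x; split=> //; rewrite /phi1_row phix; congr (_, _).
  by apply/rowP => -[[|[|[|k]]] ltk]; rewrite !mxE //=; congr (h 0 _); apply: val_inj.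
- move=> x Rx; rewrite -phi_ker // /phi1_row.
  case: (phi1 x) => [[[a b] c] d]; split.
    case=> /rowP r ->; move: (r 0) (r 1) (r 2%:R); rewrite !mxE /=.
    by move=> -> -> ->.
  by case=> -> -> -> ->; congr (_, _); apply/rowP => -[[|[|[|k]]] ltk]; rewrite !mxE.
Qed.

(** * Commutators descend *)

Lemma depthW m f : depth m.+1 f -> depth m f.
Proof.
case=> f0 f1 evf odf; split=> // k lek; first by apply: evf; apply: leqW.
case/andP: lek => k0 ltk; apply: odf; rewrite k0 (leq_trans ltk) //.
by rewrite leq_double leqnSn.
Qed.

Lemma depth_lead m f : depth m.+1 f -> (0 < m)%N ->
  [/\ ev f m.+1 = 0, od f m.*2 = 0 & od f m.*2.+1 = 0].
Proof.
case=> _ _ evf odf m0; split; first exact: evf.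
  by apply: odf; rewrite double_gt0 m0 doubleS ltnS leqnSn.
by apply: odf; rewrite doubleS ltnSn.
Qed.

(** At depth [m.+1] every coefficient related by [lead_rel m] is zero. *)
Lemma depth_lead_rel m f : depth m.+1 f -> lead_rel m f.
Proof.
move=> df; rewrite /lead_rel; case: m df => // m df.
have [-> -> ->] := depth_lead df isT.
by case: ifP => //; rewrite mulr0.
Qed.

Lemma Gam_decr m x : Gam m.+1 x -> Gam m x.
Proof.
case=> x10 df _ xsm; split=> //; [exact: depthW|exact: depth_lead_rel|].
move=> k /andP[k0 ltk]; apply: xsm; rewrite k0 (leq_trans ltk) //.
by rewrite leq_double leqnSn.
Qed.

Lemma Gam_le m k x : (m <= k)%N -> Gam k x -> Gam m x.
Proof.
elim: k => [|k IH]; first by rewrite leqn0 => /eqP->.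
by rewrite leq_eqVlt => /predU1P[->//|ltm] /Gam_decr; apply: IH.
Qed.

Lemma depth_Gam m f : depth m.+1 f -> Gam m (1%S, f).
Proof.
move=> df; split=> //=; [exact: depthW|exact: depth_lead_rel|].
by case.
Qed.

(** [K] is the kernel of [phi] on [G]. By induction this makes each [Gam m] a subgroup without any
    computation with inverses. *)
Lemma quot_iso_subgroup (G K : RR -> Prop) (H : zmodType) (phi : RR -> H) :
  subgroupR G -> quot_iso G K phi -> (forall x, K x -> G x) -> subgroupR K.
Proof.
move=> [GR G1 GM GV] [phiM _ phiK] KG.
have phi1 : phi rid = 0.
  by apply: (@addrI _ (phi rid)); rewrite -phiM // rmul1x ?addr0.
split=> [x /KG/GR//||x y Kx Ky|x y Kx Ry xy]; first by apply/phiK.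
  have [Gx Gy] := (KG _ Kx, KG _ Ky); apply/phiK; first exact: GM.
  by rewrite phiM // (phiK x Gx).2 // (phiK y Gy).2 // addr0.
have Gx := KG _ Kx; have Gy := GV _ _ Gx Ry xy; apply/phiK => //.
by rewrite -phi1 -xy phiM // (phiK x Gx).2 // add0r.
Qed.

Lemma subgroup_Rg : subgroupR Rg.
Proof. by split=> //; apply: isR_mul. Qed.

Lemma subgroup_Gam m : subgroupR (Gam m).
Proof.
elim: m => [|[|m] IH].
- by split=> [x /Gam0//||x y /Gam0 Rx /Gam0 Ry|x y _ Ry _]; apply/Gam0 => //;
    apply: isR_mul.
- by apply: quot_iso_subgroup subgroup_Rg phi1_quot_iso _ => x /Gam_isR.
- apply: quot_iso_subgroup IH (phi_quot_iso _ erefl) _ => // x; exact: Gam_decr.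
Qed.

(** The last coefficient read is [od x.2 (2m+1)], of index [4m+3] in the series, just below the
    bound. *)
Lemma Gam_agree m x y : agree m.+1.*2.*2 x y -> isR x -> Gam m y -> Gam m x.
Proof.
move=> xy [x10 [x20 x21]] [y10 [_ _ evf odf] rel ysm].
have odE k : (k < m.+1.*2)%N -> od x.2 k = od y.2 k.
  by move=> ltk; apply: (xy _ _).2; rewrite -doubleS leq_double.
have evE k : (k < m.+1.*2)%N -> ev x.2 k = ev y.2 k.
  by move=> ltk; apply: (xy _ _).2; rewrite ltn_double.
have m1 : (m.+1 < m.+1.*2)%N by rewrite doubleS !ltnS -addnn leq_addr.
have m2 : (m.*2.+1 < m.+1.*2)%N by rewrite doubleS.
split=> //.
- split=> // k lek.
    by rewrite evE ?evf // (leq_ltn_trans lek) // ltnW.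
  case/andP: (lek) => k0 ltk; by rewrite odE ?odf // (ltn_trans ltk (ltnW m2)).
- move: rel; by rewrite /lead_rel !odE ?evE // ltnW.
- move=> k /andP[k0 ltk]; rewrite (xy k _).1 ?ysm ?k0 //.
  by rewrite (leq_trans ltk) // leq_double (leq_trans (leqnSn m)) // -addnn leq_addr.
Qed.

Lemma closed_Gam m : closedR (Gam m).
Proof. by move=> x Rx /(_ m.+1.*2.*2)[y [Gy xy]]; apply: Gam_agree Gy. Qed.

(** At [m = 0] the abelian target of [phi1] kills commutators. Above that, [comm_depth] gives the
    leading coefficients, and the relation known for [x] turns into the next relation for [c]. *)
Lemma Gam_comm m x y (c : RR) : Gam m x -> isR y -> is_comm x y c -> Gam m.+1 c.
Proof.
case: m => [|m] Gx Ry [Rc cE].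
  have Rx := Gam_isR Gx; apply/phi1_ker => //.
  apply: (@addrI _ (phi1 (rmul y x))).
  by rewrite -phi1_mul ?cE ?addr0 ?phi1_mul ?[_ + phi1 x]addrC //; apply: isR_mul.
have [x10 df rel xsm] := Gx; have [f0 f1 _ _] := df.
have [y10 [g0 g1]] := Ry; have [c10 [c20 c21]] := Rc.
have c1E := congr1 fst cE; have c2E := congr1 snd cE; rewrite /= in c1E c2E.
have [dc c0E c1E' evcE] := comm_depth (isT : (0 < m.+1)%N) df g0 g1 c20 c21 c2E.
split=> //.
  rewrite /lead_rel doubleS c0E c1E' evcE; move: rel; rewrite /lead_rel [odd m.+2]/= [odd m.+1]/=.
  (* The depth is [m.+1] here; its residue modulo 2 decides the form of [lead_rel], so both
     multiples are expressed by the parity of [m]. *)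
  have oddE : m.+1%:R = (~~ odd m)%:R :> 'F_2.
    elim: (m) => // k IH; rewrite -natr1 IH /=.
    by case: (odd k); apply: val_inj.
  have oddE' : m.+2%:R = (odd m)%:R :> 'F_2.
    by rewrite -natr1 oddE; case: (odd m); apply: val_inj.
  rewrite oddE oddE'; case odd_m: (odd m) => /=.
    move=> /(_ isT) ->; have -> : (m.+1 == 1%N) = false.
      by apply/negbTE; apply: contraTneq odd_m => -[->].
    by rewrite !mul0r !mul1r; split; F2ring.
  move=> [-> ->] _; rewrite !mul0r !mul1r.
  by case: (m.+1 == 1%N) => /=; rewrite ?mul0r ?mul1r; F2ring.
have [B [fE _]] := depthE (isT : (0 < m.+1)%N) (depth_od df) (depth_ev df).
have aE : (x.1 = 1 + 't^ m.+1.*2 * (fun n => (x.1 + 1)%S (m.+1.*2 + n)%N))%S.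
  rewrite -tn_factor; first by ring.
  by case=> [|k] ltk; rewrite padd_coef; [rewrite x10 addFF|rewrite xsm // addr0].
have [E [eE _]] := cocycle_comm_jet aE x10 y10 fE g0 g1 c1E.
case=> // k /andP[_ ltk]; rewrite eE padd_coef -!ppowSM coef_tnM -doubleS.
by rewrite ltk addr0.
Qed.

Lemma pcomp_injl p q f : f 0%N = 0 -> f 1%N = 1 -> (p @@ f = q @@ f)%S -> p = q.
Proof.
move=> f0 f1 e; have [g [g0 _ fg]] := pcomp_inv f0 f1.
by rewrite -(pcomp_id p) -(pcomp_id q) -fg -!pcompA // e.
Qed.

Lemma comm_N x y (c : RR) : Ng x -> Ng y -> is_comm x y c -> Ng c.
Proof.
move=> [Rx x1] [Ry y1] [Rc cE]; split=> //.
have [_ [x20 x21]] := Rx; have [_ [y20 y21]] := Ry.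
move: (congr1 fst cE); rewrite /= x1 y1 !pcomp1 !pmul1s => c1E.
apply: (@pcomp_injl _ _ (x.2 @@ y.2)%S); rewrite ?pcomp1 //.
  by rewrite pcomp_coef0.
by rewrite pcomp_coef1 // x21 y21 mulr1.
Qed.

Lemma subgroup_Ng : subgroupR Ng.
Proof.
split=> [x []//|//|x y [Rx x1] [Ry y1]|x y [Rx x1] Ry xy]; split=> //.
- exact: isR_mul.
- by rewrite /= x1 y1 pcomp1 pmul1s.
- have [_ [x20 x21]] := Rx; move: (congr1 fst xy); rewrite /= x1 pmul1s => e.
  by apply: (@pcomp_injl _ _ x.2) => //; rewrite e pcomp1.
Qed.

Lemma closed_Ng : closedR Ng.
Proof.
move=> x Rx xcl; split=> //; apply: psP => n.
by have [y [[_ y1] /(_ n (ltnSn n))[-> _]]] := xcl n.+1; rewrite y1.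
Qed.

(** * Commutators generate *)

Definition Gam_in S m x : Prop := S x /\ Gam m x.

Lemma subgroup_Gam_in S m : subgroupR S -> subgroupR (Gam_in S m).
Proof.
move=> [SR S1 SM SV]; have [GR G1 GM GV] := subgroup_Gam m.
split=> [x [/SR]//|//|x y [Sx Gx] [Sy Gy]|x y [Sx Gx] Ry xy]; split.
- exact: SM.
- exact: GM.
- exact: SV xy.
- exact: GV xy.
Qed.

Lemma closed_Gam_in S m : closedR S -> closedR (Gam_in S m).
Proof.
move=> Scl x Rx xcl; split.
  by apply: Scl => // N; have [y [[Sy _] xy]] := xcl N; exists y.
by apply: closed_Gam => // N; have [y [[_ Gy] xy]] := xcl N; exists y.
Qed.

(** Successive approximation: an element of [D] is corrected by a left factor from [K] until it lies
    in the smaller set [D']. *)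
Definition cov K (D D' : RR -> Prop) : Prop :=
  forall r : RR, D r -> exists y (r' : RR), [/\ K y, D' r' & r = rmul y r'].

Lemma cov_trans K D1 D2 D3 : subgroupR K -> (forall x, D3 x -> isR x) ->
  cov K D1 D2 -> cov K D2 D3 -> cov K D1 D3.
Proof.
move=> [KR _ KM _] D3R c12 c23 r /c12[y [s [Ky /c23[z [t [Kz Dt ->]]] ->]]].
exists (rmul y z), t; split=> //; first exact: KM.
by rewrite rmulA //; [apply: KR|apply: KR|apply: D3R].
Qed.

Definition coords0 S m i x : Prop :=
  Gam_in S m x /\ forall k, (k < i)%N -> (coords m x)`_k = 0.

(** A witness in [K] with [i]-th coordinate 1 and earlier ones 0 clears that coordinate. The
    alternative, a coordinate vanishing identically, serves the Appell part when [S] is the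
    Nottingham group. *)
Lemma cov_coords K S m i : (0 < m)%N -> subgroupR K -> subgroupR S ->
  (exists c : RR, [/\ K c, coords0 S m i c & (coords m c)`_i = 1]) \/
    (forall x, coords0 S m i x -> (coords m x)`_i = 0) ->
  cov K (coords0 S m i) (coords0 S m i.+1).
Proof.
move=> m_gt0 sK sS wit r Dr; have [Sr r0] := Dr.
have [KR K1 KM KV] := sK; have [GR G1 GM GV] := subgroup_Gam_in m sS.
have zero : (coords m r)`_i = 0 -> exists y (r' : RR), [/\ K y, coords0 S m i.+1 r' & r = rmul y r'].
  move=> ri; exists rid, r; split=> //; last by rewrite rmul1x //; apply: GR.
  split=> // k; rewrite ltnS leq_eqVlt => /predU1P[->//|]; exact: r0.
case: wit => [[c [Kc [Gc c0] ci]]|/(_ _ Dr)//].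
case: (F2P (coords m r)`_i) => // ri.
have [z [Rz cz zc]] := rinv_ex (GR _ Gc).
have Gz := GV _ _ Gc Rz cz; have Gzr := GM _ _ Gz Sr.
have rE : r = rmul c (rmul z r) by rewrite rmulA ?cz ?rmul1x //; apply: GR.
exists c, (rmul z r); split=> //; split=> // k; rewrite ltnS leq_eqVlt => ltk.
have := @coords_mul m c (rmul z r) k m_gt0 Gc.2 Gzr.2; rewrite -rE.
case/predU1P: ltk => [->|ltk]; last by rewrite c0 // r0 // add0r => <-.
rewrite ri ci => /eqP; rewrite -[X in X == _]addr0 (inj_eq (addrI _)).
by move/eqP.
Qed.

Lemma cov_Gam K S m : (0 < m)%N -> subgroupR K -> subgroupR S ->
  (forall i, (i < if odd m then 4 else 6)%N ->
    (exists c : RR, [/\ K c, coords0 S m i c & (coords m c)`_i = 1]) \/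
    (forall x, coords0 S m i x -> (coords m x)`_i = 0)) ->
  cov K (Gam_in S m) (Gam_in S m.+1).
Proof.
move=> m_gt0 sK sS wit; set N := (if odd m then _ else _) in wit.
have [SR _ _ _] := sS; have [_ K1 _ _] := sK.
have covi i : (i <= N)%N -> cov K (Gam_in S m) (coords0 S m i).
  elim: i => [_ r Dr|i IH lti].
    by exists rid, r; split=> //; rewrite rmul1x //; apply: SR; case: Dr.
  apply: (cov_trans sK _ (IH (ltnW lti))); last by apply: cov_coords => //; apply: wit.
  by move=> x [[/SR]].
move=> r /(covi N (leqnn N))[y [r' [Ky [[Sr' Gr'] r'0] rE]]].
exists y, r'; split=> //; split=> //; apply/coords_ker => // i.
by have [/r'0//|lei] := ltnP i N; rewrite nth_default // size_coords.
Qed.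

(** The leading coefficients of a commutator with [g] depend on [g] only through [g 2] and [g 3], so
    these test elements suffice. *)
Definition cubic (e d : 'F_2) : ps := nth 0 [:: 0; 1; e; d].

Lemma N_comm_ex f g : f 0%N = 0 -> f 1%N = 1 -> g 0%N = 0 -> g 1%N = 1 ->
  exists c : ps, [/\ c 0%N = 0, c 1%N = 1, (c @@ (f @@ g) = g @@ f)%S &
     is_comm (1%S, f) (1%S, g) (1%S, c)].
Proof.
move=> f0 f1 g0 g1.
have Nf : Ng (1%S, f) by []; have Ng' : Ng (1%S, g) by [].
have [[c1 c] cc] := comm_ex Nf.1 Ng'.1.
have [_ /= c1E] := comm_N Nf Ng' cc; rewrite c1E in cc.
have [[_ [c0 c11]] cE] := cc; exists c; split=> //.
exact: (congr1 snd cE).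
Qed.

Definition comm_in S K j : Prop :=
  forall x y (c : RR), Gam_in S j x -> S y -> is_comm x y c -> K c.

Lemma comm_nott S K j f g : (forall x, Ng x -> S x) -> comm_in S K j ->
  Gam j (1%S, f) -> g 0%N = 0 -> g 1%N = 1 ->
  exists c : ps, [/\ K (1%S, c), Gam_in S j.+1 (1%S, c), c 0%N = 0, c 1%N = 1 &
    (c @@ (f @@ g) = g @@ f)%S].
Proof.
move=> NS commK Gf g0 g1; have Rf := Gam_isR Gf; have [_ [f0 f1]] := Rf.
have [c [c0 c1 cE cc]] := N_comm_ex f0 f1 g0 g1.
have Ry : isR (1%S, g) by [].
exists c; split=> //.
  by apply: commK cc; [split=> //; apply: NS|apply: NS].
split; first exact: NS.
exact: Gam_comm Gf Ry cc.
Qed.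

Lemma comm_lead_ev S K j : (forall x, Ng x -> S x) -> comm_in S K j ->
  exists c : ps, [/\ K (1%S, c), Gam_in S j.+1 (1%S, c) & ev c j.+2 = 1].
Proof.
move=> NS commK; have g01 : cubic 0 1 0%N = 0 by []; have g11 : cubic 0 1 1%N = 1 by [].
have [j0|j_gt0] := posnP j.
  (* [comm_depth] requires positive depth, so for [j = 0] the commutator of t + t^2 and t + t^3 is
     computed directly. *)
  have Gf : Gam j (1%S, cubic 1 0) by rewrite j0; apply/Gam0.
  have [c [Kc Gc c0 c1 cE]] := comm_nott NS commK Gf g01 g11.
  exists c; split=> //; have [_ [_ [_ _ evc odc] _ _]] := Gc; rewrite j0 in evc odc *.
  have f0 : cubic 1 0 0%N = 0 by []; have f1 : cubic 1 0 1%N = 1 by [].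
  have fg0 : (cubic 1%R 0%R @@ cubic 0%R 1%R)%S 0%N = 0 by rewrite pcomp_coef0.
  have fg1 : (cubic 1%R 0%R @@ cubic 0%R 1%R)%S 1%N = 1 by rewrite pcomp_coef1 // mulr1.
  have [_ _ _ _] := pcomp_low c0 c1 fg0 fg1.
  rewrite cE; have [_ _ _ _ ->] := pcomp_low g01 g11 f0 f1.
  have [_ _ _ _ ->] := pcomp_low f0 f1 g01 g11.
  have ec1 : ev c 1%N = 0 by apply: evc.
  have oc1 : od c 1%N = 0 by apply: odc.
  rewrite ec1 oc1 [ev (_ @@ _)%S _ * 0]mulr0 [0 * ev (_ @@ _)%S _]mul0r.
  by case: (F2P (ev c 2%N)) => -> // /(congr1 val).
(* The u-tail is forced by [lead_rel j] once the leading coefficient of [ev] is 1. *)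
pose s : seq 'F_2 := if odd j then [:: 1; (j == 1%N)%:R] else [:: 0; 1].
have Gf : Gam j (1%S, odev (unit_tail j.*2 s) (tail j.+1 [:: 1])).
  have := @Gam_odev j s [:: 1] [::] j_gt0.
  case=> [|_ df rel _]; last by split=> // -[].
  by rewrite /s; case: (odd j) => //=; rewrite mulr1.
have [c [Kc Gc c0 c1 cE]] := comm_nott NS commK Gf g01 g11.
exists c; split=> //; have [_ _ _ ->] := comm_depth j_gt0 (depth_odev _ _ _) g01 g11 c0 c1 cE.
by rewrite ev_unique tail_coef /= -[cubic 0 1 2%N]/0 -[cubic 0 1 3%N]/1; F2ring.
Qed.

Lemma comm_lead_od S K j : (forall x, Ng x -> S x) -> comm_in S K j ->
  odd j ->
  exists c : ps, [/\ K (1%S, c), Gam_in S j.+1 (1%S, c), ev c j.+2 = 0 & od c j.+1.*2 = 1].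
Proof.
move=> NS commK odd_j; have j_gt0 : (0 < j)%N by case: (j) odd_j.
(* This value as [g 3] cancels the exceptional term of [ev c] at [j = 1]; in [od c] it occurs twice
   and drops out. *)
pose d : 'F_2 := (j == 1%N)%:R.
have g0 : cubic 1 d 0%N = 0 by []; have g1 : cubic 1 d 1%N = 1 by [].
have Gf : Gam j (1%S, odev (unit_tail j.*2 [:: 1; d]) (tail j.+1 [:: 1])).
  have := @Gam_odev j [:: 1; d] [:: 1] [::] j_gt0.
  case=> [|_ df rel _]; last by split=> // -[].
  by rewrite odd_j /= mulr1.
have [c [Kc Gc c0 c1 cE]] := comm_nott NS commK Gf g0 g1.
exists c.
have [_ -> _ ->] := comm_depth j_gt0 (depth_odev _ _ _) g0 g1 c0 c1 cE.
rewrite od_unique ev_unique !unit_tail_coef // tail_coef /= -[cubic 1 d 2%N]/1 -[cubic 1 d 3%N]/d.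
have oddE : j%:R = 1 :> 'F_2.
  by rewrite -(odd_double_half j) odd_j natrD -addnn natrD addFF addr0.
by rewrite -natr1 oddE /d; split=> //; F2ring.
Qed.

(** Starting one level deeper, with an [f] of depth [j.+1] whose only leading term is [od] at
    [2j+3], shifts the commutator past the first coordinates. Such an [f] lies in [Gam j] though not
    always in [Gam j.+1]. *)
Lemma comm_deep S K j (e d : 'F_2) : (forall x, Ng x -> S x) -> comm_in S K j ->
  exists c : ps, [/\ K (1%S, c), Gam_in S j.+1 (1%S, c),
  depth j.+2 c, od c j.+1.*2.+2 = e &
  od c j.+1.*2.+3 = d + j.+1%:R * e /\ ev c j.+3 = 0].
Proof.
move=> NS commK; have g0 : cubic e d 0%N = 0 by []; have g1 : cubic e d 1%N = 1 by [].
have df := depth_odev j.+1 [:: 0; 1] [::].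
have [c [Kc Gc c0 c1 cE]] := comm_nott NS commK (depth_Gam df) g0 g1.
exists c; have [dc -> -> ->] := comm_depth (isT : (0 < j.+1)%N) df g0 g1 c0 c1 cE.
rewrite od_unique ev_unique !unit_tail_coef // tail_coef /= -[cubic e d 2%N]/e -[cubic e d 3%N]/d.
by split=> //; [F2ring|split; F2ring].
Qed.

Lemma comm_appell S K j (e d : 'F_2) : (forall x, Rg x -> S x) -> comm_in S K j ->
  exists c1 : ps, [/\ K (c1, pX), Gam_in S j.+1 (c1, pX), c1 j.+1.*2 = e &
    e = 0 -> c1 j.+1.*2.+1 = d].
Proof.
(* The exponent [2j+1] makes the tail [A] of [a] equal to t, so the leading coefficient of the
   commutator is [g 2 = e]. *)
move=> RS commK; pose a : ps := unit_tail j.*2 [:: 0; 1].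
have aE : (a = 1 + 't^ j.*2 * pX)%S.
  apply: psP => k; rewrite padd_coef coef_tnM /a /unit_tail /pone.
  case: k => [|k] /=; first by case: (j) => [|i]; rewrite addr0.
  case: ltnP => ltk; first by rewrite addr0.
  by rewrite add0r; case: (k.+1 - j.*2)%N => [|[|[]]].
have Ga : Gam j (a, pX).
  have dX n : depth n pX by split=> // -[|[|k]].
  split=> //; first exact: depth_lead_rel.
  by case=> // k /andP[_ ltk]; rewrite /a /unit_tail /= ltk.
have Rg' : isR (1%S, cubic e d) by [].
have [[c1 c2] cc] := comm_ex (Gam_isR Ga) Rg'.
have Gc := Gam_comm Ga Rg' cc; have [Rc cE] := cc.
have g0 : cubic e d 0%N = 0 by []; have g1 : cubic e d 1%N = 1 by [].
have c2E : c2 = pX.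
  have := congr1 snd cE; rewrite /= (pcomp_X g0) pcomp_id => c2g.
  by apply: (@pcomp_injl _ _ (cubic e d)); rewrite ?pcomp_X.
rewrite c2E in cc Gc Rc; exists c1.
have := congr1 fst cE; rewrite /= => c1E.
have XE : (pX = pX + pX * (pX * ('t^ j.*2 * 0)))%S by ring.
have a0 : a 0%N = 1 by [].
have [E [eE [E0 E1]]] := cocycle_comm_jet aE a0 (erefl : 1%S 0%N = 1) XE g0 g1 c1E.
have coefE k : c1 (j.*2.+2 + k)%N = E k.
  by rewrite eE padd_coef -!ppowSM coef_tnM ltnNge leq_addr addKn add0r.
rewrite -[cubic e d 2%N]/e -[cubic e d 3%N]/d !jetE in E0 E1.
split.
- by apply: commK cc; [split=> //; apply: RS; apply: Gam_isR Ga|apply: RS].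
- by split=> //; apply: RS.
- by rewrite doubleS -(addn0 j.*2.+2) coefE E0.
- by move=> e0; rewrite doubleS -(addn1 j.*2.+2) coefE E1 e0; F2ring.
Qed.

Lemma cov_step S K j : subgroupR K -> S = Rg \/ S = Ng -> comm_in S K j ->
  cov K (Gam_in S j.+1) (Gam_in S j.+2).
Proof.
move=> sK SE commK.
have NS x : Ng x -> S x by case: SE => -> //; case.
have sS : subgroupR S by case: SE => ->; [exact: subgroup_Rg|exact: subgroup_Ng].
apply: cov_Gam => //= i; rewrite /coords0 /coords /=.
have witA (e d : 'F_2) : S = Rg ->
  exists c1 : ps, [/\ K (c1, pX), Gam_in S j.+1 (c1, pX), c1 j.+1.*2 = e &
    e = 0 -> c1 j.+1.*2.+1 = d].
  by move=> SR; apply: comm_appell => //; rewrite SR.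
have zeroA k x : (0 < k)%N -> S x -> S = Ng -> x.1 k = 0.
  by move=> k0 Sx SN; move: Sx; rewrite SN => -[_ ->]; case: k k0.
have odX k : (0 < k)%N -> od pX k = 0 by case: k.
have evX k : ev pX k = 0 by case: k.
(* The u- and v-coordinates are produced by Nottingham commutators, leading ones first. The last two
   are Appell coordinates, obtained from [comm_appell] when [S] is [Rg] and identically zero when it
   is [Ng]. *)
case odd_j: (odd j) => /=.
- case: i => [|[|[|[|[|[|i]]]]]] // _.
  + left; have [c [Kc Gc evc]] := comm_lead_ev NS commK.
    by exists (1%S, c).
  + left; have [c [Kc Gc ev0 od1]] := comm_lead_od NS commK odd_j.
    by exists (1%S, c); split=> //; split=> // -[].
  + left; have [c [Kc Gc dc od2 [od3 ev3]]] := comm_deep 1 0 NS commK.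
    have [e0 o0 o1] := depth_lead dc isT.
    exists (1%S, c); split=> //=; last by rewrite od2 ev3 addr0.
    by split=> // -[|[|]].
  + left; have [c [Kc Gc dc od2 [od3 ev3]]] := comm_deep 0 1 NS commK.
    have [e0 o0 o1] := depth_lead dc isT.
    exists (1%S, c); split=> //=; last by rewrite od3 mulr0 addr0.
    by split=> // -[|[|[|]]] //= _; rewrite od2 ev3 addr0.
  + case: SE => SE; last by right=> x [[Sx _] _]; apply: zeroA.
    left; have [c1 [Kc Gc c10 _]] := witA 1 0 SE.
    exists (c1, pX); split=> //; split=> // -[|[|[|[|]]]] //= _.
    by rewrite odX // evX addr0.
  + case: SE => SE; last by right=> x [[Sx _] _]; apply: zeroA.
    left; have [c1 [Kc Gc c10 /(_ erefl) c11]] := witA 0 1 SE.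
    exists (c1, pX); split=> //; split=> // -[|[|[|[|[|]]]]] //= _.
    by rewrite odX // evX addr0.
- case: i => [|[|[|[|i]]]] // _.
  + left; have [c [Kc Gc evc]] := comm_lead_ev NS commK.
    by exists (1%S, c).
  + left; have [c [Kc Gc dc od2 [od3 ev3]]] := comm_deep 0 1 NS commK.
    have [e0 o0 o1] := depth_lead dc isT.
    exists (1%S, c); split=> //=; last by rewrite od3 ev3 mulr0 !addr0.
    by split=> // -[|].
  + case: SE => SE; last by right=> x [[Sx _] _]; apply: zeroA.
    left; have [c1 [Kc Gc c10 _]] := witA 1 0 SE.
    exists (c1, pX); split=> //; split=> // -[|[|]] //= _.
    by rewrite odX // evX addr0.
  + case: SE => SE; last by right=> x [[Sx _] _]; apply: zeroA.
    left; have [c1 [Kc Gc c10 /(_ erefl) c11]] := witA 0 1 SE.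
    exists (c1, pX); split=> //; split=> // -[|[|[|]]] //= _.
    by rewrite odX // evX addr0.
Qed.

(** * Identification of the lower central series with the candidate filtration *)

Lemma lcs_sub_Gam S m x : S = Rg \/ S = Ng -> lcs S m x -> Gam_in S m x.
Proof.
move=> SE.
have sS : subgroupR S by case: SE => ->; [exact: subgroup_Rg|exact: subgroup_Ng].
have clS : closedR S by case: SE => ->; [move=> y Ry _|exact: closed_Ng].
have [SR _ _ _] := sS.
elim: m x => [|m IH] x /=; first by move=> Sx; split=> //; apply/Gam0; apply: SR.
apply; [exact: subgroup_Gam_in|exact: closed_Gam_in|].
move=> c [y [z [/IH[Sy Gy] [Sz cc]]]]; split; last exact: Gam_comm Gy (SR _ Sz) cc.
case: SE Sy Sz => -> Sy Sz; first by case: cc.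
exact: comm_N Sy Sz cc.
Qed.

(** Both components of an element of [Gam m] agree with the identity modulo [t^(2m)], so the
    filtration shrinks to the identity. *)
Lemma Gam_agree_mul m y x : isR y -> Gam m x -> agree m.*2 (rmul y x) y.
Proof.
move=> [y10 [y20 y21]] [x10 [f0 f1 evf odf] _ xsm] n ltn; split=> /=.
  have x1 : eqm m.*2 x.1 1%S by case=> [|k] ltk //; rewrite xsm.
  have := eqmM (@eqm_refl m.*2 y.1) (eqm_compl y20 x1).
  by move/(_ n ltn)->; rewrite pcomp1 pmulC pmul1s.
have x2 : eqm m.*2 x.2 pX.
  move=> k ltk; rewrite -(odd_double_half k).
  have ltk2 : (k./2 < m)%N.
    by rewrite -ltn_double (leq_ltn_trans _ ltk) // -{2}(odd_double_half k) leq_addl.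
  case: (odd k); rewrite ?add0n ?add1n.
    case: (k./2) ltk2 => [|i] lti; first by rewrite f1.
    rewrite -[LHS]/(od x.2 i.+1) odf //= (leq_trans lti) // -addnn leq_addr //.
  rewrite -[LHS]/(ev x.2 k./2) evf ?(ltnW ltk2) //.
  by rewrite /pX; case: (k./2).
by have := eqm_compl y20 x2 ltn; rewrite pcomp_X.
Qed.

Lemma Gam_sub_lcs S m x : S = Rg \/ S = Ng -> Gam_in S m x -> lcs S m x.
Proof.
move=> SE.
have sS : subgroupR S by case: SE => ->; [exact: subgroup_Rg|exact: subgroup_Ng].
elim: m x => [|m IH] x; first by case.
move=> Gx K sK clK KT; have [KR K1 KM KV] := sK.
(* Because [Gam j] lies in [Gam m] for [j >= m], commutators at all deeper levels are already in
   [K]; they allow the correction to continue indefinitely. *)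
have commK j : (m <= j)%N -> comm_in S K j.
  move=> lemj y z c [Sy Gy] Sz cc; apply: KT; exists y, z; split=> //.
  by apply: IH; split=> //; apply: Gam_le Gy.
have covj j : cov K (Gam_in S m.+1) (Gam_in S (m.+1 + j)).
  elim: j => [|j IHj].
    move=> r Gr; exists rid, r; rewrite addn0; split=> //.
    by rewrite rmul1x //; apply: Gam_isR Gr.2.
  rewrite addnS; apply: cov_trans IHj _ => //; first by move=> y [_ /Gam_isR].
  by rewrite addSn; apply: cov_step => //; apply: commK; apply: leq_addr.
apply: clK; first exact: Gam_isR Gx.2.
(* After [N] corrections the remainder lies in [Gam (m.+1 + N)] and is invisible below index [N];
   closedness of [K] concludes. *)
move=> N; have [y [r [Ky [_ Gr] ->]]] := covj N x Gx.
exists y; split=> // n ltn; apply: (Gam_agree_mul (KR _ Ky) Gr).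
by rewrite (leq_trans ltn) // -addnn -addnA addnC -addnA leq_addr.
Qed.

Lemma gammaRE n x : gamma Rg n.+1 x <-> Gam n x.
Proof.
split; first by move/(@lcs_sub_Gam Rg n x (or_introl erefl)); case.
move=> Gx; apply: (@Gam_sub_lcs Rg n x (or_introl erefl)).
by split=> //; apply: Gam_isR Gx.
Qed.

Lemma gammaNE n x : gamma Ng n.+1 x <-> Ng x /\ Gam n x.
Proof.
split; first by move/(@lcs_sub_Gam Ng n x (or_intror erefl)).
exact: (@Gam_sub_lcs Ng n x (or_intror erefl)).
Qed.

Lemma quot_iso_eq (G K G' K' : RR -> Prop) (H : zmodType) (phi : RR -> H) :
  (forall x, G x <-> G' x) -> (forall x, K x <-> K' x) ->
  quot_iso G K phi -> quot_iso G' K' phi.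
Proof.
move=> GE KE [phiM phi_onto phiK]; split.
- by move=> x y /GE Gx /GE Gy; apply: phiM.
- by move=> h; have [x [/GE Gx <-]] := phi_onto h; exists x.
- by move=> x /GE Gx; rewrite (phiK x Gx).
Qed.

Theorem theorem7 :
  (forall n : nat, (2 <= n)%N -> forall x : RR,
     gamma Rg n x <->
     exists a h, Am (2 * n - 3)%N a /\ gamma Ng n h /\ x = rmul a h) /\
  (exists phi : RR -> ('rV['Z_2]_3 * 'Z_4)%type,
     quot_iso (gamma Rg 1) (gamma Rg 2) phi) /\
  (forall i : nat, (2 <= i)%N -> ~~ odd i ->
     exists phi : RR -> 'rV['Z_2]_4, quot_iso (gamma Rg i) (gamma Rg i.+1) phi) /\
  (forall i : nat, (1 < i)%N -> odd i ->
     exists phi : RR -> 'rV['Z_2]_6, quot_iso (gamma Rg i) (gamma Rg i.+1) phi) /\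
  (exists phi : RR -> ('Z_2 * 'Z_4 * 'Z_2 * 'Z_2)%type,
     [/\ quot_iso Rg (gamma Rg 2) phi,
         phi ael = (1, 0, 0, 0),
         phi (bel 1) = (0, 1, 0, 0),
         phi (rmul (bel 1) (bel 2)) = (0, 0, 1, 0) &
         phi (bel 4) = (0, 0, 0, 1)]).
Proof.
have symE n x : Gam n x <-> gamma Rg n.+1 x by rewrite gammaRE.
split.
  case=> // m; rewrite ltnS => m_gt0.
  have mE : (2 * m.+1 - 3 = m.*2.-1)%N by rewrite mul2n doubleS subSS subSS subn1.
  have ltE k : (k <= m.*2.-1)%N = (k < m.*2)%N.
    by rewrite -ltnS prednK // double_gt0.
  move=> x; rewrite gammaRE mE; split.
    move=> Gx; have Rx := Gam_isR Gx; have [x10 dx rel xsm] := Gx.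
    (* The semidirect factorization (g, f) = (g, t)(1, f). *)
    exists (x.1, pX), (1%S, x.2); split; last split.
    - split=> [|k k0]; first by split=> //; case: Rx.
      by rewrite ltE => ltk; apply: xsm; rewrite k0.
    - apply/gammaNE; split; first by split=> //; case: Rx.
      by split=> // -[].
    - by rewrite /rmul /= pcomp1 pcomp_id pmulC pmul1s; case: (x).
  move=> [a [h [[[Ra aX] asm] [/gammaNE[[_ h1] [_ dh rel _]] ->]]]].
  rewrite /rmul aX h1 pcomp1 pcomp_id pmulC pmul1s; split=> //=; first by case: Ra.
  by move=> k /andP[k0 ltk]; apply: asm; rewrite ?ltE.
split; first by exists phi1_row; exact: quot_iso_eq (fun x => iff_refl _) (symE 1%N) phi1_row_quot_iso.
split.
  case=> // m; rewrite ltnS /= negbK => m_gt0 odd_m; exists (phi 4 m).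
  by apply: quot_iso_eq (symE m) (symE m.+1) (phi_quot_iso m_gt0 _); rewrite odd_m.
split.
  case=> // m; rewrite ltnS /= => m_gt0 /negbTE odd_m; exists (phi 6 m).
  by apply: quot_iso_eq (symE m) (symE m.+1) (phi_quot_iso m_gt0 _); rewrite odd_m.
exists phi1; split.
- exact: quot_iso_eq (fun x => iff_refl _) (symE 1%N) phi1_quot_iso.
- exact: phi1_ael.
- exact: phi1_bel1.
- exact: phi1_bel12.
- exact: phi1_bel4.
Qed.
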